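(* Let $\Gamma$ be a distance-regular graph with valency $k\geq 3$, diameter $D\geq 3$ and distinct eigenvalues $k=\theta_0>\theta_1>\cdots>\theta_D$ such that $1<\theta_1\leq 2$. Then the intersection array of $\Gamma$ is one of the following 23 arrays: $\{3,2,2;1,1,3\}$, $\{4,3,2;1,2,4\}$, $\{4,3,3;1,1,4\}$, $\{5,4,3;1,2,5\}$, $\{5,4,4;1,1,5\}$, $\{6,5,3;1,3,6\}$, $\{6,5,4;1,2,6\}$, $\{7,6,4;1,3,7\}$, $\{8,7,4;1,4,8\}$, $\{9,8,3;1,6,9\}$, $\{10,9,4;1,6,10\}$, $\{16,15,4;1,12,16\}$, $\{3,2,2,1;1,1,2,3\}$, $\{3,2,2,2;1,1,1,3\}$, $\{4,3,2,1;1,2,3,4\}$, $\{4,3,3,1;1,1,3,4\}$, $\{3,2,2,1,1;1,1,2,2,3\}$, $\{4,2,1;1,1,4\}$, $\{4,3,3;1,1,2\}$, $\{5,4,2;1,1,4\}$, $\{6,5,1;1,1,6\}$, $\{8,6,1;1,3,8\}$, $\{3,2,2,1;1,1,1,2\}$.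
   Context: All graphs are finite, simple, undirected and connected. $\Gamma$ is distance-regular with diameter $D$ if there are integers $b_i,c_i$ such that for all vertices $x,y$ with $d(x,y)=i$, $y$ has exactly $c_i$ neighbours at distance $i-1$ from $x$ and $b_i$ neighbours at distance $i+1$ from $x$; the valency is $k=b_0$. The intersection array is $\{b_0,b_1,\ldots,b_{D-1};c_1,c_2,\ldots,c_D\}$. Eigenvalues are those of the adjacency matrix. *)

(* Defs.v *)
From HB Require Import structures.
From mathcomp Require Import all_boot all_order all_algebra.
Set Implicit Arguments. Unset Strict Implicit. Unset Printing Implicit Defensive.
Import Order.TTheory GRing.Theory Num.Theory.

Definition simple_graph (n : nat) (e : rel 'I_n) : Prop :=
  symmetric e /\ irreflexive e.

Fixpoint within (n : nat) (e : rel 'I_n) (m : nat) (x y : 'I_n) : bool :=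
  match m with
  | 0 => x == y
  | m'.+1 => within e m' x y || [exists z, within e m' x z && e z y]
  end.

(* Graph distance: the least m (< n) with a walk of length <= m from x to y;
   (equal to n when y is unreachable, which never happens for connected graphs). *)
Definition gdist (n : nat) (e : rel 'I_n) (x y : 'I_n) : nat :=
  find (fun m => within e m x y) (iota 0 n).

(* [is_DRG e b c] : the graph is a (finite, simple, connected) distance-regular
   graph with diameter D := size b and intersection array
   {b`_0, ..., b`_(D-1) ; c`_0, ..., c`_(D-1)} = {b_0,...,b_{D-1}; c_1,...,c_D}. *)
Definition is_DRG (n : nat) (e : rel 'I_n) (b c : seq nat) : Prop :=
  simple_graph e /\
  (forall x y, connect e x y) /\
  size c = size b /\
  (forall x y, gdist e x y <= size b)%N /\
  (exists x y, gdist e x y = size b) /\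
  (forall x y,
         ((gdist e x y < size b)%N ->
            #|[set z | e y z & gdist e x z == (gdist e x y).+1]|
            = nth 0%N b (gdist e x y)) /\
         ((0 < gdist e x y)%N ->
            #|[set z | e y z & gdist e x z == (gdist e x y).-1]|
            = nth 0%N c (gdist e x y).-1)).

Definition adjmx (R : nzRingType) (n : nat) (e : rel 'I_n) : 'M[R]_n :=
  \matrix_(i, j) (e i j)%:R%R.

Local Open Scope ring_scope.

(* th is theta_1, the second largest distinct eigenvalue of A, given that the
   largest eigenvalue theta_0 is k (true for a k-regular connected graph):
   th is an eigenvalue, th < k, and every eigenvalue below k is <= th. *)
Definition is_theta1 (R : rcfType) (n : nat) (A : 'M[R]_n) (k th : R) : Prop :=
  [/\ eigenvalue A th, th < k &
      forall mu, eigenvalue A mu -> mu < k -> mu <= th].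

Local Close Scope ring_scope.

Definition arrays_thm4p3 : seq (seq nat * seq nat) :=
  [:: ([:: 3;2;2], [:: 1;1;3]);
      ([:: 4;3;2], [:: 1;2;4]);
      ([:: 4;3;3], [:: 1;1;4]);
      ([:: 5;4;3], [:: 1;2;5]);
      ([:: 5;4;4], [:: 1;1;5]);
      ([:: 6;5;3], [:: 1;3;6]);
      ([:: 6;5;4], [:: 1;2;6]);
      ([:: 7;6;4], [:: 1;3;7]);
      ([:: 8;7;4], [:: 1;4;8]);
      ([:: 9;8;3], [:: 1;6;9]);
      ([:: 10;9;4], [:: 1;6;10]);
      ([:: 16;15;4], [:: 1;12;16]);
      ([:: 3;2;2;1], [:: 1;1;2;3]);
      ([:: 3;2;2;2], [:: 1;1;1;3]);
      ([:: 4;3;2;1], [:: 1;2;3;4]);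
      ([:: 4;3;3;1], [:: 1;1;3;4]);
      ([:: 3;2;2;1;1], [:: 1;1;2;2;3]);
      ([:: 4;2;1], [:: 1;1;4]);
      ([:: 4;3;3], [:: 1;1;2]);
      ([:: 5;4;2], [:: 1;1;4]);
      ([:: 6;5;1], [:: 1;1;6]);
      ([:: 8;6;1], [:: 1;3;8]);
      ([:: 3;2;2;1], [:: 1;1;1;2])].

(* Main.v *)
(* Write q_i = c_1 ... c_i (v_0 + ... + v_i) for the scaled sums of distance polynomials; q_D has the
   eigenvalues other than k as roots. By a Sturm argument theta_1 <= 2 forces
   q_i(2) > 0 for i < D and q_D(2) >= 0. These inequalities are strong enough to force k <= 4 when
   D >= 4 and, when D = 3, either k <= 20 or b_2 = 1 and c_3 = k, i.e. the graph is an antipodal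
   cover of a complete graph. The finitely many arrays of the first kind are sieved by integrality
   of the sphere sizes k_i, parity of k_i a_i, the condition c_2 | k (b_2 - 1) when D = 3 and
   a_3 = 0, and integrality of multiplicities, read off from the trace of the idempotent
   E = sum_i u_i(theta) A_i up to scaling. For antipodal covers the roots of x^2 - (a_1 - c_2) x - k
   are integral unless a_1 = c_2, which leaves theta_1 = 2 and a divisibility condition; the
   last candidate {20,18,1;1,9,20} violates a Krein condition. *)
From Stdlib Require Import ZArith Lia.
Require Import Defs.
From HB Require Import structures.
From mathcomp Require Import all_boot all_order all_algebra all_field.
From mathcomp Require Import zify ring lra ssrZ.
From mathcomp Require polyrcf.
Set Implicit Arguments. Unset Strict Implicit. Unset Printing Implicit Defensive.
Import Order.TTheory GRing.Theory Num.Theory.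

(** * Graph distance *)

Section GraphDistance.

Variables (n : nat) (e : rel 'I_n).
Hypotheses (e_sym : symmetric e) (e_irr : irreflexive e).
Hypothesis e_conn : forall x y, connect e x y.

Local Notation d := (gdist e).

Lemma within_addn i j x y z :
  within e i x y -> within e j y z -> within e (i + j) x z.
Proof.
move=> xy; elim: j z => [|j IH] z /=; first by move/eqP<-; rewrite addn0.
rewrite addnS /= => /orP[/IH-> //|/existsP[t /andP[/IH xt tz]]].
by apply/orP; right; apply/existsP; exists t; rewrite xt.
Qed.

Lemma within1 x y : e x y -> within e 1 x y.
Proof. by move=> xy; apply/orP; right; apply/existsP; exists x; rewrite /= eqxx. Qed.

Lemma within_sym m x y : within e m x y -> within e m y x.
Proof.
elim: m x y => [|m IH] x y /=; first by rewrite eq_sym.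
case/orP=> [/IH-> //|/existsP[z /andP[/IH zx zy]]].
by rewrite -[_ || _]/(within e m.+1 y x) -add1n (@within_addn 1 m y z x) // within1 // e_sym.
Qed.

Lemma within_leq i j x y : i <= j -> within e i x y -> within e j x y.
Proof.
move=> /subnK<-; rewrite addnC => xy.
by apply: (within_addn xy); elim: (j - i) => [|m IH] //=; rewrite IH.
Qed.

Lemma within_lt_order x y : exists2 m, m < n & within e m x y.
Proof.
case/connectP: (e_conn x y) => p + ->.
case/shortenP=> p' pp' up' _.
exists (size p').
  by have := uniq_leq_size up' (fun z _ => mem_enum 'I_n z); rewrite size_enum_ord.
elim/last_ind: p' pp' {up'} => [|p' z IH] /=; first by rewrite eqxx.
rewrite rcons_path size_rcons last_rcons /= => /andP[/IH xp pz].
by apply/orP; right; apply/existsP; exists (last x p'); rewrite xp.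
Qed.

Lemma gdist_leP m x y : (d x y <= m) = within e m x y.
Proof.
rewrite /gdist; set P := fun m => _.
have [m0 m0n wm0] := within_lt_order x y.
have hasP : has P (iota 0 n) by apply/hasP; exists m0; rewrite ?mem_iota.
have ltn : find P (iota 0 n) < n by rewrite -[X in _ < X](size_iota 0 n) -has_find.
apply/idP/idP => [le|wm].
  by apply: within_leq le _; have := nth_find 0 hasP; rewrite nth_iota.
rewrite leqNgt; apply/negP=> lt; have := before_find 0 lt.
by rewrite nth_iota ?(ltn_trans lt) // /P add0n wm.
Qed.

Lemma gdist_sym x y : d x y = d y x.
Proof.
by apply/eqP; rewrite eqn_leq !gdist_leP; apply/andP; split; apply: within_sym; rewrite -gdist_leP.
Qed.

Lemma gdist_eq0 x y : (d x y == 0) = (x == y).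
Proof. by rewrite -leqn0 gdist_leP. Qed.

Lemma gdist_xx x : d x x = 0.
Proof. by apply/eqP; rewrite gdist_eq0. Qed.

Lemma gdist_edge x y z : e y z -> d x z <= (d x y).+1.
Proof.
by move=> yz; rewrite gdist_leP -addn1; apply: within_addn (within1 yz); rewrite -gdist_leP.
Qed.

Lemma gdist_eq1 x y : (d x y == 1) = e x y.
Proof.
apply/idP/idP => [/eqP d1|xy].
  have := leqnn (d x y); rewrite {2}d1 gdist_leP /= -gdist_eq0 d1 /=.
  by case/existsP=> z /andP[/eqP<-].
rewrite eqn_leq gdist_leP within1 //= lt0n gdist_eq0.
by apply/eqP=> exy; rewrite exy e_irr in xy.
Qed.

Lemma gdist_pred x y m : d x y = m.+1 -> exists2 z, d x z = m & e z y.
Proof.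
move=> dxy; have := leqnn (d x y); rewrite {2}dxy gdist_leP /= -gdist_leP dxy ltnn /=.
case/existsP=> z /andP[xz zy]; exists z => //.
apply/eqP; rewrite eqn_leq gdist_leP xz /=.
by have := gdist_edge x zy; rewrite dxy ltnS.
Qed.

Lemma gdist_pred_le x y i : i <= d x y -> exists z, d x z = i.
Proof.
move En: (d x y) => N; elim: N y En => [|N IH] y En.
  by rewrite leqn0 => /eqP->; exists y.
rewrite leq_eqVlt => /predU1P[->|]; first by exists y.
by have [z /IH] := gdist_pred En.
Qed.

End GraphDistance.

(** * Intersection numbers *)

(* The entry [nth 0 c j] is c_(j+1); [cnth] restores the paper's indexing, with c_0 = 0. *)
Definition cnth (c : seq nat) i := if i is j.+1 then nth 0 c j else 0.
Definition anth (b c : seq nat) i := nth 0 b 0 - nth 0 b i - cnth c i.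
Arguments cnth : simpl never.

Lemma even_sum_degrees (T : finType) (r : rel T) (S : {set T}) :
  symmetric r -> irreflexive r ->
  ~~ odd (\sum_(y in S) #|[set z in S | r y z]|).
Proof.
move=> r_sym r_irr; pose lt (y z : T) := enum_rank y < enum_rank z.
suff -> : \sum_(y in S) #|[set z in S | r y z]|
        = (\sum_(y in S) #|[set z in S | r y z & lt y z]|).*2 by rewrite odd_double.
rewrite -addnn [X in _ = _ + X](_ : _ = \sum_(y in S) #|[set z in S | r y z & lt z y]|).
  rewrite -big_split; apply: eq_bigr => y yS /=.
  rewrite -cardsUI [X in _ = _ + X](_ : _ = 0) ?addn0; last first.
    apply: eq_card0 => z; rewrite !inE /lt; case: (r y z); rewrite ?andbF //=.
    by case: (z \in S) => //=; lia.
  apply: eq_card => z; rewrite !inE; case: (z \in S) => //=.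
  case ryz: (r y z) => //=; rewrite /lt -neq_ltn.
  by apply/esym; apply: contraTneq ryz => /ord_inj/enum_rank_inj->; rewrite r_irr.
transitivity (\sum_(y in S) \sum_(z in S | r y z && lt y z) 1).
  by apply: eq_bigr => y _; rewrite -sum1_card; apply: eq_bigl => z; rewrite inE.
rewrite (exchange_big_dep (mem S)) /=; last by move=> y z _ /andP[].
apply: eq_bigr => y yS; rewrite -sum1_card; apply: eq_bigl => z.
by rewrite inE yS r_sym.
Qed.

Section DistanceRegular.

Variables (n : nat) (e : rel 'I_n) (b c : seq nat).
Hypothesis drg : is_DRG e b c.

Local Notation d := (gdist e).
Local Notation D := (size b).
Local Notation bn := (nth 0 b).
Local Notation cn := (cnth c).
Local Notation an := (anth b c).

Let e_sym : symmetric e. Proof. by case: drg => [[]]. Qed.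
Let e_irr : irreflexive e. Proof. by case: drg => [[]]. Qed.
Let e_conn x y : connect e x y. Proof. by case: drg => _ []. Qed.

Lemma drg_size : size c = D.
Proof. by case: drg => _ [_ []]. Qed.

Lemma drg_gdist_le x y : d x y <= D.
Proof. by case: drg => _ [_ [_ [+ _]]]; apply. Qed.

Lemma drg_diameter : exists x, forall i, i <= D -> exists y, d x y = i.
Proof.
case: drg => _ [_ [_ [_ [[x [y dxy]] _]]]]; exists x => i le.
by apply: (gdist_pred_le e_conn (y := y)); rewrite dxy.
Qed.

Lemma drg_card_succ x y : #|[set z | e y z & d x z == (d x y).+1]| = bn (d x y).
Proof.
case: (ltnP (d x y) D) => lt.
  by case: drg => _ [_ [_ [_ [_ /(_ x y)[+ _]]]]]; apply.
rewrite nth_default //; apply: eq_card0 => z; rewrite !inE.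
by apply/negP=> /andP[_ /eqP ez]; have := drg_gdist_le x z; rewrite ez ltnNge lt.
Qed.

Lemma drg_card_pred x y : #|[set z | e y z & (d x z).+1 == d x y]| = cn (d x y).
Proof.
case: drg => _ [_ [_ [_ [_ /(_ x y)[_]]]]].
rewrite /cnth; case: (d x y) => [_|i /= /(_ isT) <-]; last by apply: eq_card => z; rewrite !inE eqSS.
by apply: eq_card0 => z; rewrite !inE andbF.
Qed.

Lemma drg_degree y : #|[set z | e y z]| = bn 0.
Proof.
have := drg_card_succ y y; rewrite (gdist_xx e_conn) => <-.
by apply: eq_card => z; rewrite !inE gdist_eq1 // andbb.
Qed.

Lemma drg_nbr_dist x y z : e y z ->
  [|| d x z == (d x y).+1, (d x z).+1 == d x y | d x z == d x y].
Proof.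
move=> yz; have := gdist_edge e_conn x yz.
have := gdist_edge e_conn x (etrans (e_sym z y) yz); lia.
Qed.

Lemma drg_sum_nbr_split (V : nmodType) (F : nat -> V) x y :
  (\sum_(z | e y z) F (d x z) =
   F (d x y).-1 *+ cn (d x y)
   + F (d x y) *+ #|[set z | e y z & d x z == d x y]| + F (d x y).+1 *+ bn (d x y))%R.
Proof.
rewrite (bigID (fun z => d x z == (d x y).+1)) /= addrC; congr (_ + _)%R; last first.
  rewrite -drg_card_succ -sumr_const; apply: eq_big => z; first by rewrite inE.
  by case/andP=> _ /eqP->.
rewrite (bigID (fun z => (d x z).+1 == d x y)) /=; congr (_ + _)%R.
  rewrite -drg_card_pred -sumr_const; apply: eq_big => z.
    by rewrite inE; case: (e y z) => //=; lia.
  by case/andP=> _ /eqP<-.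
rewrite -sumr_const; apply: eq_big => z; last first.
  by case/andP=> /andP[/(drg_nbr_dist x) near succ] pred; congr F; lia.
rewrite inE; case yz: (e y z) => //=; have := drg_nbr_dist x yz; lia.
Qed.

Lemma drg_degree_split x y :
  bn 0 = cn (d x y) + #|[set z | e y z & d x z == d x y]| + bn (d x y).
Proof.
rewrite -(drg_degree y) -sum1_card.
rewrite (eq_bigl (e y)); last by move=> z; rewrite inE.
have := drg_sum_nbr_split (fun=> 1) x y.
by have one m : (1%N *+ m)%R = m :> nat by [exact: natn]; rewrite !one.
Qed.

Lemma drg_card_eq x y : #|[set z | e y z & d x z == d x y]| = an (d x y).
Proof. by rewrite /anth [X in X - _ - _](drg_degree_split x y); lia. Qed.

Lemma drg_sum_nbr (V : nmodType) (F : nat -> V) x y :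
  (\sum_(z | e y z) F (d x z) =
   F (d x y).-1 *+ cn (d x y) + F (d x y) *+ an (d x y) + F (d x y).+1 *+ bn (d x y))%R.
Proof. by rewrite drg_sum_nbr_split drg_card_eq. Qed.

Lemma drg_abc i : i <= D -> an i + bn i + cn i = bn 0.
Proof.
move=> le; have [x /(_ _ le)[y <-]] := drg_diameter.
by rewrite -drg_card_eq [bn 0](drg_degree_split x y); lia.
Qed.

Lemma drg_c_gt0 i : 0 < i <= D -> 0 < cn i.
Proof.
case: i => // i /andP[_ le]; have [x /(_ _ le)[y dxy]] := drg_diameter.
have [z dz zy] := gdist_pred e_conn dxy.
by rewrite -dxy -drg_card_pred (cardD1 z) inE e_sym zy dz dxy eqxx.
Qed.

Lemma drg_b_gt0 i : i < D -> 0 < bn i.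
Proof.
move=> lt; have [x /(_ _ lt)[y dxy]] := drg_diameter.
have [z dz zy] := gdist_pred e_conn dxy.
by rewrite -dz -drg_card_succ (cardD1 y) inE zy dz dxy eqxx.
Qed.

Lemma drg_c1 : 0 < D -> cn 1 = 1.
Proof.
move=> D_gt0; have [x /(_ _ D_gt0)[y dxy]] := drg_diameter.
have := drg_card_pred x y; rewrite dxy => <-.
transitivity #|[set x]|; last exact: cards1.
apply: eq_card => z.
rewrite !inE eqSS gdist_eq0 // eq_sym; case: eqP => [->|]; rewrite ?andbF //.
by rewrite e_sym -(gdist_eq1 e_irr e_conn) dxy.
Qed.

Lemma drg_mono i : i < D -> cn i <= cn i.+1 /\ bn i.+1 <= bn i.
Proof.
move=> lt; have [x /(_ _ lt)[y]] := drg_diameter.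
rewrite (gdist_sym e_sym e_conn) => dyx.
have [x' + x'x] := gdist_pred e_conn dyx.
move: dyx; rewrite ![d y _](gdist_sym e_sym e_conn) => dxy dx'y.
have close z : d x z <= (d x' z).+1 /\ d x' z <= (d x z).+1.
  rewrite ![d _ z](gdist_sym e_sym e_conn).
  by split; apply: gdist_edge => //; rewrite e_sym.
split.
  have := drg_card_pred x y; rewrite dxy => <-; have := drg_card_pred x' y; rewrite dx'y => <-.
  apply: subset_leq_card.
  apply/subsetP=> z; rewrite !inE => /andP[yz]; rewrite yz /=.
  by have := drg_nbr_dist x yz; have := close z; lia.
have := drg_card_succ x y; rewrite dxy => <-; have := drg_card_succ x' y; rewrite dx'y => <-.
apply: subset_leq_card.
apply/subsetP=> z; rewrite !inE => /andP[yz]; rewrite yz /=.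
by have := drg_nbr_dist x' yz; have := close z; lia.
Qed.

Definition sphere x i := #|[set y | d x y == i]|.

Lemma sphere0 x : sphere x 0 = 1.
Proof.
transitivity #|[set x]|; last exact: cards1.
apply: eq_card => y.
by rewrite !inE gdist_eq0 // eq_sym.
Qed.

Lemma sphere_rec x i : sphere x i * bn i = sphere x i.+1 * cn i.+1.
Proof.
pose S j := [set y | d x y == j].
transitivity (\sum_(y in S i) \sum_(z | e y z && (d x z == i.+1)) 1).
  rewrite -sum_nat_const; apply: eq_bigr => y; rewrite inE => /eqP<-.
  by rewrite -drg_card_succ -sum1_card; apply: eq_bigl => z; rewrite inE.
rewrite (exchange_big_dep (fun z => d x z == i.+1)) /=; last by move=> y z _ /andP[].
rewrite -sum_nat_const; apply: eq_big => z; first by rewrite inE.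
move=> /eqP dz; have := drg_card_pred x z; rewrite dz => <-; rewrite -sum1_card.
by apply: eq_bigl => y; rewrite !inE eqSS eqxx andbT andbC e_sym.
Qed.

Lemma sum_dist (V : nmodType) (F : nat -> V) x :
  (\sum_y F (d x y) = \sum_(i < D.+1) F i *+ sphere x i)%R.
Proof.
rewrite (partition_big (fun y => Ordinal (drg_gdist_le x y : d x y < D.+1)) xpredT) //=.
apply: eq_bigr => i _; rewrite -sumr_const; apply: eq_big => y; first by rewrite inE -val_eqE.
by move/eqP <-.
Qed.

Lemma sum_sphere x : \sum_(i < D.+1) sphere x i = n.
Proof.
have := sum_dist (fun=> 1%N) x; rewrite sum1_card card_ord => ->.
by apply: eq_bigr => i _; rewrite (natn (sphere x i)).
Qed.

Lemma drg_handshake x i : ~~ odd (sphere x i * an i).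
Proof.
have -> : sphere x i * an i = \sum_(y in [set y | d x y == i]) #|[set z in [set y | d x y == i] | e y z]|.
  rewrite -sum_nat_const; apply: eq_bigr => y; rewrite inE => /eqP<-.
  by rewrite -drg_card_eq; apply: eq_card => z; rewrite !inE andbC.
exact: even_sum_degrees.
Qed.

(* Count the paths y - w - z with z != y in the sphere of radius 3 around x: since that sphere
   contains no edge (a_3 = 0), each z at distance 2 from y is reached c_2 times. *)
Lemma drg_c2_dvd : D = 3 -> an 3 = 0 -> cn 2 %| bn 0 * (bn 2).-1.
Proof.
move=> D3 a3; have [x /(_ 3)] := drg_diameter; rewrite D3 => /(_ isT) [y dxy].
have nbr3 y' w : d x y' = 3 -> e y' w -> d x w = 2.
  move=> dy' yw; have := drg_nbr_dist x yw; rewrite dy' => /or3P[]/eqP; last 1 first.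
  - move=> dw; have := drg_card_eq x y'; rewrite dy' a3 => /eqP; rewrite cards_eq0.
    by move/eqP/setP/(_ w); rewrite !inE yw dw eqxx.
  - by move=> dw; have := drg_gdist_le x w; rewrite D3 dw.
  - by case.
pose S := [set z | d x z == 3 & z != y].
have: \sum_(w | e y w) \sum_(z in S | e w z) 1 = bn 0 * (bn 2).-1.
  rewrite -(drg_degree y) -sum_nat_const.
  apply: eq_big => w; first by rewrite inE.
  move=> yw; have := drg_card_succ x w; rewrite (nbr3 y w dxy yw) => <-.
  rewrite (cardD1 y) inE e_sym yw dxy eqxx add1n -sum1_card; apply: eq_bigl => z.
  by rewrite !inE; case: (z == y) => //=; rewrite ?andbF // andbT andbC.
rewrite (exchange_big_dep (mem S)) /=; last by move=> w z _ /andP[].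
move<-; apply: dvdn_sum => z; rewrite !inE => /andP[/eqP dz zy].
rewrite (eq_bigl (fun w => e y w && e w z)) => [|w]; last by rewrite dz zy.
rewrite sum1dep_card; case: (posnP #|[set w | e y w & e w z]|) => [->|H]; first by rewrite dvdn0.
have dyz : d y z = 2.
  case/card_gt0P: H => w; rewrite !inE => /andP[yw wz].
  have := gdist_edge e_conn y wz.
  have := yw; rewrite -(gdist_eq1 e_irr e_conn) => /eqP->.
  case: (d y z) (gdist_eq0 e_conn y z) (gdist_eq1 e_irr e_conn y z) => [|[|[|m]]] //.
    by rewrite eq_sym (negPf zy).
  by move=> _ yz; have := nbr3 y z dxy (esym yz); rewrite dz.
have := drg_card_pred y z; rewrite dyz => <-.
rewrite [X in _ %| X](_ : _ = #|[set w | e z w & (d y w).+1 == 2]|) //.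
by apply: eq_card => w; rewrite !inE eqSS gdist_eq1 // andbC e_sym.
Qed.

End DistanceRegular.

(** * Eigenvectors and multiplicities *)

Local Open Scope ring_scope.

(* [Useq b c x i] is c_1 ... c_i v_i(x) and also b_0 ... b_(i-1) u_i(x), where v_i and (u_i) are the
   distance polynomials and the standard sequence; [qseq b c x i] is c_1 ... c_i (v_0 + ... + v_i)(x). *)
Fixpoint Useq (R : pzRingType) (b c : seq nat) (x : R) (i : nat) : R :=
  match i with
  | 0 => 1
  | j.+1 => match j with
            | 0 => x
            | m.+1 => (x - (anth b c j)%:R) * Useq b c x j
                      - (nth 0%N b m * cnth c j)%:R * Useq b c x m
            end
  end.

Fixpoint qseq (R : pzRingType) (b c : seq nat) (x : R) (i : nat) : R :=
  if i is j.+1 then Useq b c x j.+1 + (cnth c j.+1)%:R * qseq b c x j else 1.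

Definition bprod (b : seq nat) i := (\prod_(i <= j < size b) nth 0 b j)%N.
Definition cprod (c : seq nat) i := (\prod_(i <= j < size c) cnth c j.+1)%N.

Definition Ssum (R : pzRingType) (b c : seq nat) (x : R) : R :=
  \sum_(i < (size b).+1) Useq b c x i ^+ 2 * (bprod b i * cprod c i)%:R.

Lemma UseqSS (R : pzRingType) b c (x : R) i :
  Useq b c x i.+2 = (x - (anth b c i.+1)%:R) * Useq b c x i.+1
                    - (nth 0%N b i * cnth c i.+1)%:R * Useq b c x i.
Proof. by []. Qed.

Lemma Useq0 (R : pzRingType) b c (x : R) : Useq b c x 0 = 1.
Proof. by []. Qed.

Lemma Useq1 (R : pzRingType) b c (x : R) : Useq b c x 1 = x.
Proof. by []. Qed.

Lemma qseqS (R : pzRingType) b c (x : R) i :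
  qseq b c x i.+1 = Useq b c x i.+1 + (cnth c i.+1)%:R * qseq b c x i.
Proof. by []. Qed.

Lemma qseq0 (R : pzRingType) b c (x : R) : qseq b c x 0 = 1.
Proof. by []. Qed.

Arguments Useq : simpl never.
Arguments qseq : simpl never.

Lemma mxtrace_scaled_idem (F : fieldType) m (M : 'M[F]_m) s :
  M *m M = s *: M -> \tr M = s * (\rank M)%:R.
Proof.
move=> MM; move: (col_base M) (row_base M) (mulmx_base M) (col_base_full M) (row_base_free M).
move=> C B defM C_full B_free; move: MM; rewrite -{1 2 3}defM => MM.
have BC : B *m C = s%:M.
  apply: (row_full_inj C_full); apply: (row_free_inj B_free).
  by rewrite /= mul_mx_scalar -scalemxAl -MM !mulmxA.
by rewrite -{1}defM mxtrace_mulC BC mxtrace_scalar mulr_natr.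
Qed.

Section Spectrum.

Variables (n : nat) (e : rel 'I_n) (b c : seq nat).
Hypothesis drg : is_DRG e b c.

Local Notation d := (gdist e).
Local Notation D := (size b).
Local Notation bn := (nth 0%N b).
Local Notation cn := (cnth c).
Local Notation an := (anth b c).

Let e_sym : symmetric e. Proof. by case: drg => [[]]. Qed.
Let e_conn x y : connect e x y. Proof. by case: drg => _ []. Qed.

Lemma bprodS i : (i < D)%N -> bprod b i = (bn i * bprod b i.+1)%N.
Proof. by move=> lt; rewrite /bprod big_ltn. Qed.

Lemma UseqS_q (R : comPzRingType) (x : R) i : (i <= D)%N ->
  Useq b c x i.+1 = (bn i)%:R * Useq b c x i + (x - (bn 0)%:R) * qseq b c x i.
Proof.
elim: i => [|i IH] le; first by rewrite Useq0 Useq1 qseq0; ring.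
rewrite UseqSS qseqS.
have /(congr1 (fun m => m%:R : R)) := drg_abc drg le; rewrite !natrD => abc.
have {IH} := IH (ltnW le); rewrite natrM => E.
have -> : (an i.+1)%:R = (bn 0)%:R - (bn i.+1)%:R - (cn i.+1)%:R :> R by rewrite -abc; ring.
have -> : (bn i)%:R * (cn i.+1)%:R * Useq b c x i =
          (cn i.+1)%:R * (Useq b c x i.+1 - (x - (bn 0)%:R) * qseq b c x i) by rewrite E; ring.
ring.
Qed.

Lemma qseqSS (R : comPzRingType) (x : R) i : (i < D)%N ->
  qseq b c x i.+2 = (x - (bn 0)%:R + (bn i.+1)%:R + (cn i.+2)%:R) * qseq b c x i.+1
                    - (bn i.+1 * cn i.+1)%:R * qseq b c x i.
Proof. by move=> lt; rewrite qseqS UseqS_q // natrM !qseqS; ring. Qed.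

Lemma Useq_last (R : comPzRingType) (x : R) :
  Useq b c x D.+1 = (x - (bn 0)%:R) * qseq b c x D.
Proof. by rewrite UseqS_q // nth_default // mul0r add0r. Qed.

Definition distmx (R : nzRingType) i : 'M[R]_n := \matrix_(x, y) (d x y == i)%:R.

Local Notation A R := (adjmx R e).

Lemma distmx_mul_adj (R : nzRingType) i x y : (distmx R i *m A R) x y =
  (cn i.+1)%:R * (d x y == i.+1)%:R + (an i)%:R * (d x y == i)%:R
  + (if i is j.+1 then (bn j)%:R * (d x y == j)%:R else 0).
Proof.
rewrite !mxE (eq_bigr (fun z => if e y z then (d x z == i)%:R else 0)) => [|z _]; last first.
  by rewrite !mxE e_sym; case: (e y z); rewrite ?mulr1 ?mulr0.
rewrite -big_mkcond /= (drg_sum_nbr drg (fun j => (j == i)%:R)); congr (_ + _ + _).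
- rewrite mulr_natl; case: (d x y) => [|j] /=; first by rewrite mulr0n mul0rn.
  by rewrite eqSS; case: eqP => [->|]; rewrite ?mul0rn.
- by rewrite mulr_natl; case: eqP => [->|]; rewrite ?mul0rn.
- by case: i => [|i]; rewrite ?mulr_natl ?mul0rn // eqSS; case: eqP => [->|]; rewrite ?mul0rn.
Qed.

Section Eigenvectors.

Variables (F : fieldType) (p : nat) (th : F) (X : 'M[F]_(n, p)).
Hypothesis AX : A F *m X = th *: X.

Lemma distmx_eigen i :
  (\prod_(0 <= j < i) cn j.+1)%N%:R *: (distmx F i *m X) = Useq b c th i *: X.
Proof.
have A0 : distmx F 0 *m X = X.
  rewrite (_ : distmx F 0 = 1%:M) ?mul1mx //; apply/matrixP=> x y.
  by rewrite !mxE (gdist_eq0 e_conn).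
have rec j : (cn j.+1)%:R *: (distmx F j.+1 *m X) = th *: (distmx F j *m X)
     - (an j)%:R *: (distmx F j *m X)
     - (if j is m.+1 then (bn m)%:R *: (distmx F m *m X) else 0).
  have -> : th *: (distmx F j *m X) = distmx F j *m A F *m X.
    by rewrite -mulmxA AX scalemxAr.
  have -> : distmx F j *m A F = (cn j.+1)%:R *: distmx F j.+1 + (an j)%:R *: distmx F j
     + (if j is m.+1 then (bn m)%:R *: distmx F m else 0).
    apply/matrixP=> x y; rewrite distmx_mul_adj.
    by case: j => [|j]; rewrite !mxE.
  rewrite !mulmxDl -!scalemxAl [X in _ = X - _]addrAC addrK.
  by case: j => [|j]; rewrite ?mul0mx -?scalemxAl addrK.
elim/ltn_ind: i => -[|[|i]] IH.
- by rewrite big_geq // !scale1r A0.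
- rewrite big_nat1 rec A0 subr0 /anth /cnth subnn sub0n scale0r subr0 //.
have C1 : (\prod_(0 <= j < i.+1) cn j.+1 = (\prod_(0 <= j < i) cn j.+1) * cn i.+1)%N.
  by rewrite big_nat_recr.
rewrite big_nat_recr //= natrM -scalerA rec !scalerBr.
have -> : (\prod_(0 <= j < i.+1) cn j.+1)%:R *: ((bn i)%:R *: (distmx F i *m X)) =
          ((bn i)%:R * (cn i.+1)%:R) *: (Useq b c th i *: X).
  by rewrite -IH ?ltnS ?leqnSn // !scalerA C1 natrM; congr (_ *: _); ring.
rewrite ![(\prod_(_ <= _ < _) _)%:R *: (_ *: _)]scalerA ![(\prod_(_ <= _ < _) _)%:R * _]mulrC.
by rewrite -!scalerA IH // !scalerA -!scalerBl UseqSS natrM; congr (_ *: _); ring.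
Qed.

Lemma Useq_eigen : X != 0 -> Useq b c th D.+1 = 0.
Proof.
move=> X0; have := distmx_eigen D.+1.
rewrite (_ : distmx F D.+1 = 0) ?mul0mx ?scaler0.
  by move/esym/eqP; rewrite scaler_eq0 (negPf X0) orbF => /eqP.
apply/matrixP=> x y; rewrite !mxE; have := drg_gdist_le drg x y.
by case: eqP => // ->; rewrite ltnn.
Qed.

End Eigenvectors.

Lemma eigenvalue_Useq (F : fieldType) (th : F) :
  eigenvalue (A F) th -> Useq b c th D.+1 = 0.
Proof.
case/eigenvalueP=> v vA v0; apply: (@Useq_eigen _ _ _ v^T); last by rewrite trmx_eq0.
have := congr1 trmx vA; rewrite trmx_mul linearZ /= => <-; congr (_ *m _).
by apply/matrixP=> x y; rewrite !mxE e_sym.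
Qed.

Section Idempotent.

Variables (F : numFieldType) (th : F).
Hypothesis Uth : Useq b c th D.+1 = 0.

Definition wseq i : F := Useq b c th i * (bprod b i)%:R.
Definition idemx : 'M[F]_n := \matrix_(x, y) wseq (d x y).

Lemma wseq_eigen j : (j <= D)%N ->
  wseq j.-1 *+ cn j + wseq j *+ an j + wseq j.+1 *+ bn j = th * wseq j.
Proof.
move=> le; rewrite -[_ *+ cn j]mulr_natr -[_ *+ an j]mulr_natr -[_ *+ bn j]mulr_natr /wseq.
have -> : Useq b c th j.+1 * (bprod b j.+1)%:R * (bn j)%:R = Useq b c th j.+1 * (bprod b j)%:R.
  move: le; rewrite leq_eqVlt => /predU1P[-> | lt]; first by rewrite Uth !mul0r.
  by rewrite (bprodS lt) natrM; ring.
case: j le => [|j] le.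
  by rewrite /anth /cnth subnn /= !mulr0 mul1r !add0r Useq1.
by rewrite UseqSS (bprodS le) !natrM; ring.
Qed.

Lemma adj_mul_idemx : A F *m idemx = th *: idemx.
Proof.
apply/matrixP=> x y; rewrite !mxE.
rewrite (eq_bigr (fun z => if e x z then wseq (d y z) else 0)) => [|z _]; last first.
  by rewrite !mxE (gdist_sym e_sym e_conn); case: (e x z); rewrite ?mul1r ?mul0r.
by rewrite -big_mkcond /= (drg_sum_nbr drg) wseq_eigen ?(drg_gdist_le drg) // (gdist_sym e_sym e_conn).
Qed.

Lemma trmx_idemx : idemx^T = idemx.
Proof. by apply/matrixP=> x y; rewrite !mxE (gdist_sym e_sym e_conn). Qed.

Lemma trmx_adj : (A F)^T = A F.
Proof. by apply/matrixP=> x y; rewrite !mxE e_sym. Qed.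

Lemma idemx_diag x : idemx x x = (bprod b 0)%:R.
Proof. by rewrite mxE (gdist_xx e_conn) /wseq Useq0 mul1r. Qed.

Lemma bprod0_gt0 : (0 < bprod b 0)%N.
Proof.
rewrite /bprod big_nat; apply: (big_ind (fun m => 0 < m)%N) => //.
  by move=> ? ?; rewrite muln_gt0 => -> .
by move=> i /andP[_ /(drg_b_gt0 drg)].
Qed.

Lemma cprod0_gt0 : (0 < cprod c 0)%N.
Proof.
rewrite /cprod big_nat; apply: (big_ind (fun m => 0 < m)%N) => //.
  by move=> ? ?; rewrite muln_gt0 => -> .
by move=> i; rewrite (drg_size drg) => /andP[_ lt]; apply: (drg_c_gt0 drg).
Qed.

Lemma root_eigenvalue : eigenvalue (A F) th.
Proof.
have [x _] := drg_diameter drg.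
apply/eigenvalueP; exists (row x idemx).
  have := congr1 trmx adj_mul_idemx; rewrite trmx_mul linearZ /= trmx_idemx trmx_adj => MA.
  by rewrite -row_mul MA linearZ.
apply/eqP=> /matrixP/(_ 0 x); rewrite !mxE (gdist_xx e_conn) /wseq Useq0 mul1r => /eqP.
by rewrite pnatr_eq0 -leqn0 leqNgt bprod0_gt0.
Qed.

Lemma idemx_sqr : (cprod c 0)%:R *: (idemx *m idemx) = Ssum b c th *: idemx.
Proof.
have -> : idemx *m idemx = \sum_(i < D.+1) wseq i *: (distmx F i *m idemx).
  rewrite {1}(_ : idemx = \sum_(i < D.+1) wseq i *: distmx F i).
    by rewrite mulmx_suml; apply: eq_bigr => i _; rewrite -scalemxAl.
  apply/matrixP=> x y; rewrite mxE summxE.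
  have lt : (d x y < D.+1)%N by rewrite ltnS (drg_gdist_le drg).
  rewrite (bigD1 (Ordinal lt)) //= !mxE eqxx mulr1 big1 ?addr0 // => i.
  by rewrite -val_eqE eq_sym !mxE /= => /negPf->; rewrite mulr0.
rewrite scaler_sumr /Ssum scaler_suml; apply: eq_bigr => i _.
have -> : cprod c 0 = ((\prod_(0 <= j < i) cn j.+1) * cprod c i)%N.
  by rewrite /cprod (big_cat_nat (n := i)) //= (drg_size drg) -ltnS.
have E := distmx_eigen adj_mul_idemx i.
transitivity ((wseq i * (cprod c i)%:R) *: (Useq b c th i *: idemx)).
  by rewrite -E !scalerA natrM; congr (_ *: _); ring.
by rewrite scalerA; congr (_ *: _); rewrite /wseq natrM; ring.
Qed.

Lemma multiplicity : exists m : nat,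
  (n * (bprod b 0 * cprod c 0))%:R = m%:R * Ssum b c th.
Proof.
have C0 : (cprod c 0)%:R != 0 :> F by rewrite pnatr_eq0 -lt0n cprod0_gt0.
have := @mxtrace_scaled_idem F _ idemx (Ssum b c th / (cprod c 0)%:R).
rewrite mulrC -scalerA -idemx_sqr scalerA mulVf // scale1r => /(_ erefl).
rewrite /mxtrace (eq_bigr (fun=> (bprod b 0)%:R)) => [|x _]; last by rewrite idemx_diag.
rewrite sumr_const card_ord => tr; exists (\rank idemx).
by rewrite !natrM mulrA mulr_natl tr; field.
Qed.

End Idempotent.

(* Krein condition: Sum_(x,y) E_xy^3 is a sum of squares when E is a positive multiple of E^2. *)
Lemma krein (F : realFieldType) (th : F) :
  Useq b c th D.+1 = 0 ->
  0 <= \sum_(x : 'I_n) \sum_(i < D.+1) wseq th i ^+ 3 *+ sphere e x i.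
Proof.
move=> Uth; have S_gt0 : 0 < Ssum b c th.
  rewrite /Ssum big_ord_recl Useq0 expr1n mul1r ltr_pwDl ?ltr0n ?muln_gt0 ?bprod0_gt0 ?cprod0_gt0 //.
  by apply: sumr_ge0 => i _; rewrite mulr_ge0 ?sqr_ge0 ?ler0n.
pose E := idemx th; pose C : F := (cprod c 0)%:R.
have C_gt0 : 0 < C by rewrite ltr0n cprod0_gt0.
pose S := Ssum b c th / C.
have S3 : 0 < S ^+ 3 by rewrite exprn_gt0 // divr_gt0.
have Esym x y : E x y = E y x by rewrite !mxE (gdist_sym e_sym e_conn).
have EE x y : S * E x y = \sum_z E x z * E y z.
  apply: (mulfI (lt0r_neq0 C_gt0)); rewrite mulrA [C * S]mulrC divfK ?lt0r_neq0 //.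
  have := congr1 (fun M : 'M_n => M x y) (idemx_sqr Uth).
  rewrite [LHS]mxE [RHS]mxE [X in _ * X = _]mxE => <-; congr (_ * _).
  by apply: eq_bigr => z _; rewrite [E y z]Esym.
have -> : \sum_(x : 'I_n) \sum_(i < D.+1) wseq th i ^+ 3 *+ sphere e x i = \sum_x \sum_y E x y ^+ 3.
  apply: eq_bigr => x _; rewrite -(sum_dist drg (fun i => wseq th i ^+ 3)).
  by apply: eq_bigr => y _; rewrite mxE.
rewrite -(pmulr_rge0 _ S3) mulr_sumr.
pose T u v w := \sum_x E x u * E x v * E x w.
suff -> : \sum_x S ^+ 3 * (\sum_y E x y ^+ 3) = \sum_u \sum_v \sum_w T u v w ^+ 2.
  by do 3![apply: sumr_ge0 => ? _]; apply: sqr_ge0.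
transitivity (\sum_x \sum_y \sum_u \sum_v \sum_w
   (E x u * E x v * E x w) * (E y u * E y v * E y w)).
  apply: eq_bigr => x _; rewrite mulr_sumr; apply: eq_bigr => y _.
  rewrite -exprMn EE !exprS expr0 mulr1 mulr_suml; apply: eq_bigr => u _.
  rewrite mulr_suml mulr_sumr; apply: eq_bigr => v _.
  by rewrite !mulr_sumr; apply: eq_bigr => w _; ring.
transitivity (\sum_u \sum_v \sum_w \sum_x \sum_y
   (E x u * E x v * E x w) * (E y u * E y v * E y w)); last first.
  do 3![apply: eq_bigr => ? _]; rewrite expr2 mulr_suml; apply: eq_bigr => x _.
  by rewrite mulr_sumr.
under eq_bigr => x _ do rewrite exchange_big /=.
rewrite exchange_big /=; apply: eq_bigr => u _.
under eq_bigr => x _ do rewrite exchange_big /=.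
rewrite exchange_big /=; apply: eq_bigr => v _.
under eq_bigr => x _ do rewrite exchange_big /=.
by rewrite exchange_big.
Qed.

End Spectrum.

(** * The condition theta_1 <= 2 *)

Lemma rmorph_Useq (R S : pzRingType) (f : {rmorphism R -> S}) b c (x : R) i :
  f (Useq b c x i) = Useq b c (f x) i.
Proof.
elim/ltn_ind: i => -[|[|i]] IH; rewrite ?Useq0 ?Useq1 ?rmorph1 //.
by rewrite !UseqSS rmorphB !rmorphM rmorphB !rmorph_nat !IH.
Qed.

Lemma rmorph_qseq (R S : pzRingType) (f : {rmorphism R -> S}) b c (x : R) i :
  f (qseq b c x i) = qseq b c (f x) i.
Proof.
elim: i => [|i IH]; first by rewrite !qseq0 rmorph1.
by rewrite !qseqS rmorphD rmorphM rmorph_nat IH rmorph_Useq.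
Qed.

Lemma horner_qseq (R : comNzRingType) b c (x : R) i : (qseq b c 'X i).[x] = qseq b c x i.
Proof. by rewrite -[LHS]/(horner_eval x _) rmorph_qseq /= /horner_eval hornerX. Qed.

Lemma last_root (R : rcfType) (p : {poly R}) (u v : R) : u <= v -> 0 < p.[v] ->
  (forall x, u <= x <= v -> 0 < p.[x]) \/
  exists r, [/\ u <= r < v, p.[r] = 0 & forall x, r < x <= v -> 0 < p.[x]].
Proof.
move=> uv pv.
have pos r : {in `]r, v[, forall z, ~~ root p z} -> forall x, r < x <= v -> 0 < p.[x].
  move=> noroot x /andP[rx xv]; rewrite ltNge; apply/negP=> px.
  have [y] := polyrcf.poly_ivt xv (mulr_le0_ge0 px (ltW pv)).
  rewrite in_itv /= => /andP[xy yv] py; move: (noroot y); rewrite in_itv /= (lt_le_trans rx xy).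
  rewrite py lt_neqAle yv andbT /= => H.
  by suff /H : y != v by []; apply: contraTneq py => ->; rewrite rootE gt_eqF.
case: (polyrcf.prev_rootP p u v) => [p0|y _ py yuv noroot|_ _ _ noroot].
- by rewrite p0 hornerE ltxx in pv.
- move: yuv; rewrite in_itv /= => /andP[uy yv]; right; exists y.
  by split=> //; [rewrite (ltW uy) | apply: pos].
have uv' : p.[u] <= 0 -> u < v.
  by move=> pu; rewrite lt_neqAle uv andbT; apply: contraTneq pv => <-; rewrite -leNgt.
case: (ltrgtP p.[u] 0) => pu.
- have [|y yuv py] := @polyrcf.poly_ivtoo _ p u v uv; first by rewrite nmulr_rlt0.
  by have := noroot y yuv; rewrite py.
- left=> x /andP[]; rewrite le_eqVlt => /predU1P[<- //|ux xv].
  by apply: (pos _ noroot); rewrite ux.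
- by right; exists u; rewrite lexx uv' ?pu ?lexx //; split=> //; apply: pos.
Qed.

Section SecondEigenvalue.

Variables (n : nat) (e : rel 'I_n) (b c : seq nat).
Hypothesis drg : is_DRG e b c.
Variable R : rcfType.

Local Notation D := (size b).
Local Notation k := ((nth 0%N b 0)%:R : R).
Local Notation q := (qseq b c).

Lemma qseq_gt0 (x : R) i : k <= x -> (i <= D)%N -> 0 < q x i.
Proof.
move=> kx; suff: (i <= D)%N -> 0 <= Useq b c x i /\ 0 < q x i by move=> H /H[].
elim: i => [|i IH] le; first by rewrite Useq0 qseq0.
have [U_ge q_gt] := IH (ltnW le).
have U_ge' : 0 <= Useq b c x i.+1.
  by rewrite (UseqS_q drg) ?(ltnW le) // addr_ge0 // mulr_ge0 ?subr_ge0 // ltW.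
split=> //; rewrite qseqS ltr_wpDl // mulr_gt0 // ltr0n.
exact: (drg_c_gt0 drg).
Qed.

(* If q_m had a root rho >= 2 with q_(m-1)(rho) > 0, then the recurrence would give
   q_(m+1)(rho) < 0, hence a root of q_(m+1) beyond rho, and so on up to q_D. *)
Lemma qseq_two : (0 < D)%N -> 2 <= k ->
    (forall r, eigenvalue (adjmx R e) r -> r < k -> r <= 2) ->
  (forall i, (i < D)%N -> 0 < q (2 : R) i) /\ 0 <= q (2 : R) D.
Proof.
move=> D_gt0 k2 second.
have kpos i : (i <= D)%N -> 0 < (q ('X : {poly R}) i).[k].
  by move=> le; rewrite horner_qseq; apply: qseq_gt0.
have noroot (r : R) : 2 < r -> r < k -> q r D != 0.
  move=> r2 rk; apply/eqP=> qr; have := second r.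
  rewrite rk leNgt r2 => /(_ _ isT)/negP; case=> //.
  apply: (root_eigenvalue drg); by rewrite (Useq_last drg) qr mulr0.
have step m (r : R) : (m.+1 < D)%N -> q r m.+1 = 0 -> 0 < q r m -> q r m.+2 < 0.
  move=> lt qr0 qr1; rewrite (qseqSS drg) ?(ltnW lt) // qr0 mulr0 sub0r oppr_lt0.
  rewrite mulr_gt0 // ltr0n muln_gt0 (drg_b_gt0 drg lt) /=.
  by apply: (drg_c_gt0 drg); lia.
have jump m (r : R) : (m.+1 < D)%N -> 2 <= r < k -> q r m.+1 = 0 -> 0 < q r m ->
    exists r', [/\ r < r' < k, q r' m.+2 = 0 & forall x, r' < x <= k -> 0 < q x m.+2].
  move=> lt /andP[r2 rk] qr0 qr1; have neg := step m r lt qr0 qr1.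
  have [pos|[r' [/andP[rr' r'k]]]] := last_root (ltW rk) (kpos _ lt).
    by have := pos r; rewrite lexx (ltW rk) horner_qseq lt_gtF // => /(_ isT).
  rewrite horner_qseq => qr' pos; exists r'; split=> //.
    by rewrite r'k lt_neqAle rr' andbT !andbT; apply: contraTneq neg => ->; rewrite qr' ltxx.
  by move=> x /pos; rewrite horner_qseq.
have claim m : (m < D)%N ->
    ((forall x : R, 2 <= x <= k -> 0 < q x m) /\ (forall j, (j <= m)%N -> 0 < q (2 : R) j)) \/
    exists m' r, [/\ m = m'.+1, 2 <= r < k, q r m = 0, 0 < q r m' & forall x, r < x <= k -> 0 < q x m].
  elim: m => [|m IH] lt.
    by left; split=> [x _|j]; rewrite ?leqn0 ?qseq0 // => /eqP->; rewrite qseq0.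
  have [[pos pos2]|[m' [r [Em /andP[r2 rk] qr0 qr1 qr]]]] := IH (ltnW lt).
    have [pos'|[r [rk qr pos']]] := last_root k2 (kpos _ (ltnW lt)).
      left; split=> [x /pos'|j]; first by rewrite horner_qseq.
      rewrite leq_eqVlt ltnS => /predU1P[->|/pos2 //].
      by rewrite -horner_qseq pos' // lexx.
    right; exists m, r; split=> //; first by rewrite -horner_qseq.
      by apply: pos; case/andP: rk => -> /ltW ->.
    by move=> x /pos'; rewrite horner_qseq.
  rewrite {m}Em in lt qr0 qr IH *.
  have [|r' [/andP[rr' r'k] qr' pos]] := jump _ _ (ltnW lt) _ qr0 qr1; first by rewrite r2.
  right; exists m'.+1, r'; split=> //; first by rewrite r'k (le_trans r2 (ltW rr')).
  by apply: qr; rewrite rr' ltW.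
case ED: D D_gt0 => [//|D'] _.
have [|[pos pos2]|[m [r [Em rk qr0 qr1 qr]]]] := claim D'; first by rewrite ED.
  split=> [i|]; first by rewrite ltnS => /pos2.
  rewrite leNgt; apply/negP=> neg.
  have := kpos D; rewrite ED => /(_ (leqnn _)) kD.
  have [pos'|[r [/andP[r2 rk] qr0 _]]] := last_root k2 kD.
    by have := pos' 2; rewrite lexx k2 horner_qseq lt_gtF // => /(_ isT).
  have r2' : 2 < r.
    rewrite lt_neqAle r2 andbT; apply: contraTneq neg => ->.
    by rewrite -horner_qseq qr0 ltxx.
  by have := noroot r r2' rk; rewrite ED -horner_qseq qr0 eqxx.
rewrite Em in qr0; have lt : (m.+1 < D)%N by rewrite -Em ED.
have [r' [/andP[rr' r'k] qr' _]] := jump m r lt rk qr0 qr1.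
have r'2 : 2 < r' by case/andP: rk => /le_lt_trans -> .
by have := noroot r' r'2 r'k; rewrite ED Em qr' eqxx.
Qed.

End SecondEigenvalue.

(** * Arithmetic modulo a minimal polynomial *)

Delimit Scope Z_scope with BZ.

Definition zr (R : pzRingType) (z : Z) : R := (int_of_Z z)%:~R.

Lemma zrD (R : pzRingType) x y : zr R (x + y)%BZ = zr R x + zr R y.
Proof. by rewrite /zr -rmorphD; congr (_%:~R); exact: (rmorphD int_of_Z). Qed.

Lemma zrM (R : pzRingType) x y : zr R (x * y)%BZ = zr R x * zr R y.
Proof. by rewrite /zr -rmorphM; congr (_%:~R); exact: (rmorphM int_of_Z). Qed.

Lemma zrN (R : pzRingType) x : zr R (- x)%BZ = - zr R x.
Proof. by rewrite /zr -rmorphN; congr (_%:~R); exact: (rmorphN int_of_Z). Qed.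

Lemma zr_nat (R : pzRingType) m : zr R (Z.of_nat m) = m%:R.
Proof. by rewrite /zr (_ : int_of_Z (Z.of_nat m) = m%:Z) ?pmulrn //; lia. Qed.

Lemma rmorph_zr (R S : pzRingType) (f : {rmorphism R -> S}) z : f (zr R z) = zr S z.
Proof. by rewrite /zr rmorph_int. Qed.

Lemma zr_eq0 (R : numDomainType) z : (zr R z == 0) = (z == 0%BZ).
Proof. by rewrite /zr intr_eq0; apply/eqP/eqP; lia. Qed.

(* Elements of Z[X]/(f) are lists of [size f] coefficients, constant term first; the monic
   polynomial f is given by its non-leading coefficients. *)
Definition addl (a b : seq Z) := [seq (p.1 + p.2)%BZ | p <- zip a b].
Definition scl (z : Z) (a : seq Z) := [seq (z * x)%BZ | x <- a].
Definition mulXl (f a : seq Z) :=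
  if a is x :: a' then addl (0%BZ :: belast x a') (scl (- last x a') f) else [::].
Definition zerol (f : seq Z) := nseq (size f) 0%BZ.
Definition mull (f a b : seq Z) :=
  foldr (fun z acc => addl (scl z b) (mulXl f acc)) (zerol f) a.
Definition onel (f : seq Z) := 1%BZ :: nseq (size f).-1 0%BZ.

Fixpoint Upair (b c : seq nat) (f : seq Z) i :=
  if i is j.+1 then
    let: (u, v) := Upair b c f j in
    (v, addl (addl (mulXl f v) (scl (- Z.of_nat (anth b c j.+1)) v))
             (scl (- (Z.of_nat (nth 0%N b j) * Z.of_nat (cnth c j.+1))) u))
  else (onel f, mulXl f (onel f)).

Definition Zprod (g : nat -> nat) i m :=
  foldr (fun j acc => (Z.of_nat (g j) * acc)%BZ) 1%BZ (iota i (m - i)).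
Definition bcprodZ (b c : seq nat) i :=
  (Zprod (nth 0%N b) i (size b) * Zprod (fun j => cnth c j.+1) i (size c))%BZ.

Definition Ssuml (b c : seq nat) (f : seq Z) :=
  foldr (fun i acc => addl (scl (bcprodZ b c i)
                               (mull f (Upair b c f i).1 (Upair b c f i).1)) acc)
        (zerol f) (iota 0 (size b).+1).

Fixpoint spheresize (b c : seq nat) i : nat :=
  if i is j.+1 then (spheresize b c j * nth 0 b j) %/ cnth c j.+1 else 1.
Definition nverts (b c : seq nat) : nat := sumn (mkseq (spheresize b c) (size b).+1).

Definition evalZ (f : seq Z) (t : Z) := foldr (fun z acc => (z + t * acc)%BZ) 1%BZ f.

Definition noZroot (f : seq Z) :=
  let m := Z.abs_nat (head 0%BZ f) in
  (head 0%BZ f != 0%BZ) &&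
  all (fun i => (evalZ f (Z.of_nat i) != 0%BZ) && (evalZ f (- Z.of_nat i) != 0%BZ)) (iota 0 m.+1).

Definition excludes (b c : seq nat) (f : seq Z) :=
  let S := Ssuml b c f in
  let N := (Z.of_nat (nverts b c) * bcprodZ b c 0)%BZ in
  [&& (size f == 1%N) || (1 < size f <= 3)%N && noZroot f,
      all (pred1 0%BZ) (Upair b c f (size b)).2 &
      ~~ (all (pred1 0%BZ) (behead S) && ((N mod head 0 S)%BZ == 0%BZ))].

Arguments onel : simpl never.
Arguments mulXl : simpl never.
Arguments addl : simpl never.
Arguments scl : simpl never.

Section Evaluation.

Variables (R : comPzRingType) (th : R).

Definition ev (a : seq Z) : R := foldr (fun z acc => zr R z + th * acc) 0 a.

Lemma ev_addl a b : size a = size b -> ev (addl a b) = ev a + ev b.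
Proof.
elim: a b => [|x a IH] [|y b] //= => [_|[sz]]; first by rewrite addr0.
by rewrite -/(addl a b) zrD -!/(ev _) IH //; ring.
Qed.

Lemma ev_scl z a : ev (scl z a) = zr R z * ev a.
Proof.
elim: a => [|x a IH] /=; first by rewrite mulr0.
by rewrite -/(scl z a) zrM -!/(ev _) IH; ring.
Qed.

Lemma ev_nseq0 m : ev (nseq m 0%BZ) = 0.
Proof. by elim: m => //= m IH; rewrite -/(ev _) IH mulr0 addr0. Qed.

Lemma ev_rcons a z : ev (rcons a z) = ev a + zr R z * th ^+ size a.
Proof.
elim: a => [|x a IH] /=; first by rewrite mulr0 addr0 add0r mulr1.
by rewrite -!/(ev _) IH exprS; ring.
Qed.

Lemma size_addl a b : size a = size b -> size (addl a b) = size b.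
Proof. by move=> sz; rewrite size_map size_zip sz minnn. Qed.

Lemma size_scl z a : size (scl z a) = size a.
Proof. by rewrite size_map. Qed.

Lemma ev_cons z a : ev (z :: a) = zr R z + th * ev a.
Proof. by []. Qed.

Arguments ev : simpl never.

Variable f : seq Z.
Hypothesis f_gt0 : (0 < size f)%N.

Lemma size_mulXl a : size a = size f -> size (mulXl f a) = size f.
Proof. by case: a => [|x a] //= sz; rewrite size_addl size_scl //= size_belast. Qed.

Lemma size_mull a b : size b = size f -> size (mull f a b) = size f.
Proof.
move=> szb; elim: a => [|z a IH] /=; first by rewrite size_nseq.
by rewrite size_addl size_mulXl // size_scl.
Qed.

Lemma size_onel : size (onel f) = size f.
Proof. by rewrite /onel /= size_nseq prednK. Qed.

Hypothesis f_root : ev f + th ^+ size f = 0.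

Lemma ev_mulXl a : size a = size f -> ev (mulXl f a) = th * ev a.
Proof.
case: a => [|x a] sz; first by rewrite mulr0.
rewrite /mulXl ev_addl; last by rewrite size_scl /= size_belast.
rewrite ev_scl zrN ev_cons [in RHS](lastI x a) ev_rcons size_belast.
have -> : th * (ev (belast x a) + zr R (last x a) * th ^+ size a) =
          th * ev (belast x a) + zr R (last x a) * th ^+ size f.
  by rewrite -sz /= exprS; ring.
have -> : th ^+ size f = - ev f by apply/eqP; rewrite -addr_eq0 addrC f_root.
by rewrite (_ : zr R 0 = 0) //; ring.
Qed.

Lemma ev_mull a b : size b = size f -> ev (mull f a b) = ev a * ev b.
Proof.
move=> szb; elim: a => [|z a IH] /=; first by rewrite ev_nseq0 mul0r.
rewrite ev_addl ?ev_scl ?ev_mulXl ?size_mulXl ?size_mull ?size_scl //.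
by rewrite ev_cons IH; ring.
Qed.

Lemma ev_onel : ev (onel f) = 1.
Proof. by rewrite /onel ev_cons ev_nseq0 mulr0 addr0. Qed.

Lemma UpairP b c i : let: (u, v) := Upair b c f i in
  [/\ size u = size f, size v = size f, ev u = Useq b c th i & ev v = Useq b c th i.+1].
Proof.
elim: i => [|i IH] /=.
  split; first exact: size_onel.
  - by rewrite size_mulXl // size_onel.
  - by rewrite ev_onel Useq0.
  - by rewrite ev_mulXl ?size_onel // ev_onel mulr1 Useq1.
case: (Upair b c f i) IH => u v [su sv eu ev'].
have s1 z : size (addl (mulXl f v) (scl z v)) = size f.
  by rewrite size_addl size_scl // size_mulXl.
split=> //; first by rewrite size_addl size_scl // s1.
rewrite ev_addl; last by rewrite s1 size_scl.
rewrite ev_addl; last by rewrite size_mulXl // size_scl.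
by rewrite !ev_scl ev_mulXl // eu ev' !zrN zrM !zr_nat UseqSS natrM; ring.
Qed.

Lemma zr_Zprod g i m : zr R (Zprod g i m) = (\prod_(i <= j < m) g j)%N%:R.
Proof.
rewrite /Zprod /index_iota; elim: (iota i (m - i)) => [|j s IH] /=; first by rewrite big_nil.
by rewrite big_cons zrM IH natrM zr_nat.
Qed.

Lemma size_Ssuml b c : size (Ssuml b c f) = size f.
Proof.
rewrite /Ssuml; elim: (iota _ _) => [|i s IH] /=; first by rewrite size_nseq.
have := UpairP b c i; case: (Upair b c f i) => u v [su _ _ _].
by rewrite size_addl ?size_scl ?size_mull.
Qed.

Lemma ev_Ssuml b c : ev (Ssuml b c f) = Ssum b c th.
Proof.
rewrite /Ssum -(big_mkord xpredT (fun i => Useq b c th i ^+ 2 * (bprod b i * cprod c i)%:R)).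
rewrite /Ssuml /index_iota subn0.
elim: (iota _ _) => [|i s IH] /=; first by rewrite big_nil ev_nseq0.
have := UpairP b c i; case: (Upair b c f i) => u v [su _ eu _] /=.
rewrite big_cons ev_addl; last first.
  rewrite size_scl size_mull //; elim: s {IH} => [|j s IH] /=; first by rewrite /zerol size_nseq.
  have := UpairP b c j; case: (Upair b c f j) => u' v' [su' _ _ _].
  by rewrite size_addl ?size_scl ?size_mull.
by rewrite IH ev_scl ev_mull // eu /bcprodZ zrM !zr_Zprod natrM -expr2 mulrC.
Qed.

End Evaluation.

Lemma rmorph_ev (R S : comPzRingType) (g : {rmorphism R -> S}) x a : g (ev x a) = ev (g x) a.
Proof.
elim: a => [|z a IH]; first by rewrite /ev /= rmorph0.
by rewrite !ev_cons rmorphD rmorphM rmorph_zr IH.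
Qed.

Lemma zr_evalZ (R : comPzRingType) f t : zr R (evalZ f t) = ev (zr R t) f + zr R t ^+ size f.
Proof.
elim: f => [|z f IH]; first by rewrite /ev /= add0r.
by rewrite ev_cons /= zrD zrM IH exprS; ring.
Qed.

Lemma noZrootP f t : (0 < size f)%N -> noZroot f -> evalZ f t != 0%BZ.
Proof.
case: f => // f0 f _ /andP[f0_neq0 /allP nroot]; rewrite [head _ _]/= in f0_neq0 nroot.
apply/eqP=> ft; have t_dvd : (t | f0)%BZ.
  by exists (- evalZ f t)%BZ; move: ft; rewrite /= -/(evalZ f t); lia.
have tle : (Z.abs t <= Z.abs f0)%BZ.
  by apply: Z.divide_pos_le; [move/eqP: f0_neq0; lia | rewrite Z.divide_abs_l Z.divide_abs_r].
have tin : Z.abs_nat t \in iota 0 (Z.abs_nat f0).+1 by rewrite mem_iota; lia.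
have /andP[] := nroot _ tin.
have [->|->] : Z.of_nat (Z.abs_nat t) = t \/ Z.of_nat (Z.abs_nat t) = (- t)%BZ by lia.
  by rewrite ft eqxx.
by rewrite Z.opp_involutive ft eqxx.
Qed.

Definition polyl (R : comNzRingType) (f : seq Z) : {poly R} := ev 'X f + 'X^(size f).

Lemma size_ev_polyX (R : comNzRingType) (f : seq Z) : (size (ev 'X f : {poly R}) <= size f)%N.
Proof.
elim: f => [|z f IH]; first by rewrite /ev size_poly0.
rewrite ev_cons (leq_trans (size_polyD _ _)) // geq_max.
rewrite -(rmorph_zr polyC) (leq_trans (size_polyC_leq1 _)) //=.
have [->|nz] := eqVneq (ev 'X f : {poly R}) 0; first by rewrite mulr0 size_poly0.
by rewrite mulrC size_mulX.
Qed.

Lemma polyl_monic (R : comNzRingType) f : polyl R f \is monic.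
Proof.
by rewrite monicE /polyl lead_coefDr ?lead_coefXn // size_polyXn ltnS size_ev_polyX.
Qed.

Lemma size_polyl (R : comNzRingType) f : size (polyl R f) = (size f).+1.
Proof. by rewrite /polyl addrC size_polyDl size_polyXn // ltnS size_ev_polyX. Qed.

Lemma horner_polyl (R : comNzRingType) f (x : R) : (polyl R f).[x] = ev x f + x ^+ size f.
Proof.
rewrite /polyl hornerD hornerXn; congr (_ + _).
by rewrite -[LHS]/(horner_eval x _) rmorph_ev /= /horner_eval hornerX.
Qed.

Lemma map_polyl (R S : comNzRingType) (g : {rmorphism R -> S}) f :
  map_poly g (polyl R f) = polyl S f.
Proof. by rewrite /polyl rmorphD rmorph_ev /= map_polyX rmorphXn /= map_polyX. Qed.

Lemma coef_ev_polyX (R : comNzRingType) f i : (ev 'X f : {poly R})`_i = zr R (nth 0%BZ f i).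
Proof.
elim: f i => [|z f IH] i; first by rewrite /ev coef0 nth_nil.
rewrite ev_cons -(rmorph_zr polyC) /= coefD coefC coefXM.
by case: i => [|i] /=; rewrite ?addr0 // IH add0r.
Qed.

Lemma polyl_irreducible f : (1 < size f <= 3)%N -> noZroot f -> irreducible_poly (polyl rat f).
Proof.
move=> /andP[f1 f3] noroot; apply: cubic_irreducible; first by rewrite size_polyl; lia.
move=> x; apply/negP=> rx; have := rx; rewrite -(fmorph_root (ratr : rat -> algC)) map_polyl => rx'.
have xint : (ratr x : algC) \in Num.int.
  apply: Cint_rat_Aint; first by apply/CratP; exists x.
  apply: root_monic_Aint rx' (polyl_monic _ _) _; apply/polyOverP => i.
  rewrite /polyl coefD coef_ev_polyX coefXn rpredD ?rpred_nat //.
  by rewrite /zr rpred_int.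
have [t Et] : exists t : Z, ratr x = zr algC t.
  case/intrP: xint => m ->; exists (Z_of_int m); by rewrite /zr Z_of_intK.
move: rx'; rewrite rootE horner_polyl /= Et -zr_evalZ zr_eq0 (negPf (noZrootP _ _ noroot)) //.
by case: f f1 {f3 noroot rx Et}.
Qed.

Lemma ev_small_eq0 f (th : algC) (g : seq Z) :
    (size f == 1%N) || (1 < size f <= 3)%N && noZroot f ->
  (polyl algC f).[th] = 0 -> (size g <= size f)%N -> ev th g = 0 -> all (pred1 0%BZ) g.
Proof.
move=> irr fth szg gth; apply/(all_nthP 0%BZ) => i ig; rewrite /= -(zr_eq0 rat) -coef_ev_polyX.
suff -> : ev 'X g = 0 :> {poly rat} by rewrite coef0.
case/orP: irr => [/eqP f1|/andP[f13 noroot]].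
  case: g gth szg {i ig} => [|z [|z' g]] gth; rewrite f1 // => _.
  move: gth; rewrite !ev_cons /ev /= !mulr0 !addr0 => /eqP; rewrite zr_eq0 => /eqP->.
  by rewrite /zr.
apply/eqP/negPn/negP=> g0.
have irrF := polyl_irreducible f13 noroot.
have : coprimep (polyl rat f) (ev 'X g).
  rewrite irreducible_poly_coprime //; apply/negP=> /(dvdp_leq g0).
  by rewrite size_polyl leqNgt ltnS (leq_trans (size_ev_polyX _ _)).
rewrite -(coprimep_map (ratr : rat -> algC)) map_polyl => cop.
have := coprimep_root cop (introT eqP fth : root _ th).
rewrite rmorph_ev /= map_polyX -[_.[_]]/(horner_eval th _) rmorph_ev /= /horner_eval hornerX.
by rewrite gth eqxx.
Qed.

Section Feasibility.

Variables (n : nat) (e : rel 'I_n) (b c : seq nat).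
Hypothesis drg : is_DRG e b c.
Local Notation D := (size b).

Lemma sphere_size x i : (i <= D)%N -> sphere e x i = spheresize b c i.
Proof.
elim: i => [|i IH] le; first by rewrite (sphere0 drg).
have := sphere_rec drg x i; rewrite IH ?(ltnW le) //= => ->.
by rewrite mulnK // (drg_c_gt0 drg).
Qed.

Lemma nverts_eq : nverts b c = n.
Proof.
have [x _] := drg_diameter drg; rewrite -(sum_sphere drg x) /nverts sumnE.
rewrite big_map -[iota _ _]/(index_iota 0 D.+1) big_mkord; apply: eq_bigr => i _.
by rewrite sphere_size // -ltnS.
Qed.

Lemma spheresize_dvd i : (i < D)%N -> (cnth c i.+1 %| spheresize b c i * nth 0%N b i)%N.
Proof.
move=> lt; have [x _] := drg_diameter drg.
by rewrite -(sphere_size x (ltnW lt)) (sphere_rec drg) dvdn_mull.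
Qed.

Lemma spheresize_even i : (i <= D)%N -> ~~ odd (spheresize b c i * anth b c i).
Proof.
move=> le; have [x _] := drg_diameter drg.
by rewrite -(sphere_size x le) (drg_handshake drg).
Qed.

Lemma krein_spheresize (F : realFieldType) (th : F) : Useq b c th D.+1 = 0 ->
  0 <= \sum_(i < D.+1) wseq b c th i ^+ 3 *+ spheresize b c i.
Proof.
move=> /(krein drg); have [x _] := drg_diameter drg.
have n_gt0 : (0 < n)%N by apply: leq_ltn_trans (ltn_ord x).
under eq_bigr => y _ do under eq_bigr => i _ do rewrite sphere_size -1?ltnS //.
by rewrite sumr_const card_ord pmulrn_lge0.
Qed.

Lemma excludesF f : excludes b c f -> False.
Proof.
rewrite /excludes; set S := Ssuml b c f; set N := (_ * _)%BZ.
move=> /and3P[irr /allP Ulast /negP]; apply.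
have f_gt0 : (0 < size f)%N by case/orP: irr => [/eqP->|/andP[/andP[/ltnW]]].
have [th /rootP fth] : exists th, root (polyl algC f) th.
  by apply/closed_rootP; rewrite size_polyl; lia.
have fth' : ev th f + th ^+ size f = 0 by rewrite -horner_polyl.
have Uth : Useq b c th D.+1 = 0.
  have := UpairP f_gt0 fth' b c D; move: Ulast; case: (Upair b c f D) => u v /= v0 [_ _ _ <-].
  elim: v v0 => [//|z v IH] v0; rewrite ev_cons IH => [|y yv]; last by apply: v0; rewrite inE yv orbT.
  by rewrite mulr0 addr0 (eqP (v0 z (mem_head _ _))).
have [m] := multiplicity drg Uth.
have NE : (n * (bprod b 0 * cprod c 0))%:R = zr algC N.
  by rewrite /N zrM /bcprodZ zrM !zr_Zprod zr_nat nverts_eq -!natrM.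
rewrite -(ev_Ssuml f_gt0 fth') -/S NE => mS.
have szS : size S = size f by exact: (size_Ssuml f_gt0 fth').
case ES : S szS mS => [|s0 s] szS mS; first by rewrite -szS in f_gt0.
pose g := (Z.of_nat m * s0 - N)%BZ :: [seq (Z.of_nat m * z)%BZ | z <- s].
have gth : ev th g = 0.
  rewrite ev_cons -/(scl _ s) ev_scl -[(_ - N)%BZ]/(_ + - N)%BZ zrD zrN zrM zr_nat mS ev_cons.
  ring.
have := ev_small_eq0 irr fth _ gth; rewrite /= size_map -szS leqnn => /(_ isT) /andP[/eqP g0 gs].
have N0 : N <> 0%BZ.
  have [x _] := drg_diameter drg; move=> N0; move/eqP: NE; rewrite N0.
  rewrite [zr _ _](_ : _ = 0) // pnatr_eq0 !muln_eq0 => /or3P[]/eqP E0.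
  - by case: x => x; rewrite E0.
  - by have := bprod0_gt0 drg; rewrite E0.
  - by have := cprod0_gt0 drg; rewrite E0.
have m0 : Z.of_nat m <> 0%BZ by move=> m0; rewrite m0 in g0; lia.
apply/andP; split.
  rewrite /=; apply/allP => z zs /=; have /= := allP gs (Z.of_nat m * z)%BZ.
  by rewrite map_f // => /(_ isT) /eqP /Z.mul_eq_0 [/m0 //|->].
by apply/eqP; rewrite /= (_ : N = (Z.of_nat m * s0)%BZ) ?Z.mod_mul //; lia.
Qed.

End Feasibility.

(** * Enumeration of arrays *)

Local Notation zn := Z.of_nat.

(* [qZ b c i] is [qseq b c 2 i.+1] followed by [qseq b c 2 i]. *)
Definition qnext (k x y z : nat) (q : Z * Z) : Z * Z :=
  (((2 - zn k + zn x + zn y) * q.1 - zn x * zn z * q.2)%BZ, q.1).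
Fixpoint qZ (b c : seq nat) i : Z * Z :=
  if i is j.+1 then qnext (nth 0%N b 0) (nth 0%N b j.+1) (cnth c j.+2) (cnth c j.+1) (qZ b c j)
  else (3, 1)%BZ.

Lemma zr_qZ n (e : rel 'I_n) b c (R : comPzRingType) i : is_DRG e b c -> (i < size b)%N ->
  zr R (qZ b c i).1 = qseq b c 2 i.+1 /\ zr R (qZ b c i).2 = qseq b c 2 i.
Proof.
move=> drg; elim: i => [|i IH] lt.
  rewrite qseqS qseq0 Useq1 (drg_c1 drg lt) mulr1; split=> //.
  by rewrite /= -[3%BZ]/(Z.of_nat 3) zr_nat; ring.
have [q1 q0] := IH (ltnW lt); split=> //.
rewrite -[(qZ b c i.+1).1]/(_ + - _)%BZ zrD zrN !zrM !zrD zrN !zr_nat q1 q0.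
rewrite (qseqSS drg) ?(ltnW lt) // natrM.
by rewrite -[2%BZ]/(Z.of_nat 2) zr_nat.
Qed.

Fixpoint level (k i : nat) : seq (seq nat * seq nat * (Z * Z)) :=
  if i is j.+1 then
    flatten [seq if (0 <? st.2.1)%BZ then
                   [seq (rcons st.1.1 x, rcons st.1.2 y, qnext k x y (last 0%N st.1.2) st.2)
                      | x <- [seq x <- iota 1 (last 0%N st.1.1) | x + last 0%N st.1.2 <= k]%N,
                        y <- iota (last 0%N st.1.2) (k.+1 - last 0%N st.1.2)]
                 else [::] | st <- level k j]
  else [:: ([:: k], [:: 1%N], (3, 1)%BZ)].

Lemma mem_level n (e : rel 'I_n) b c i : is_DRG e b c -> (i < size b)%N ->
    (forall j, (j < i)%N -> (0 < (qZ b c j).1)%BZ) ->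
  (take i.+1 b, take i.+1 c, qZ b c i) \in level (nth 0%N b 0) i.
Proof.
move=> drg; have szc := drg_size drg.
elim: i => [|i IH] lt pos.
  rewrite inE (take_nth 0%N) // (take_nth 0%N) ?szc // !take0 /=.
  by have := drg_c1 drg lt; rewrite /cnth => ->.
have {}IH := IH (ltnW lt) (fun j lt' => pos j (ltnW lt')).
apply/flattenP; exists [seq (rcons (take i.+1 b) x, rcons (take i.+1 c) y,
    qnext (nth 0%N b 0) x y (last 0%N (take i.+1 c)) (qZ b c i))
  | x <- [seq x <- iota 1 (last 0%N (take i.+1 b)) | x + last 0%N (take i.+1 c) <= nth 0%N b 0]%N,
    y <- iota (last 0%N (take i.+1 c)) ((nth 0%N b 0).+1 - last 0%N (take i.+1 c))].
  by apply/mapP; exists (take i.+1 b, take i.+1 c, qZ b c i); rewrite //= (introT (Z.ltb_spec0 _ _) (pos i _)).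
have Lb : last 0%N (take i.+1 b) = nth 0%N b i by rewrite (take_nth 0%N) ?last_rcons // ltnW.
have Lc : last 0%N (take i.+1 c) = cnth c i.+1 by rewrite (take_nth 0%N) ?last_rcons // szc ltnW.
rewrite Lb Lc; apply/allpairsPdep; exists (nth 0%N b i.+1), (cnth c i.+2).
have := drg_abc drg (ltnW lt); have := drg_abc drg lt.
have := drg_mono drg (ltnW lt); have := drg_mono drg lt; have := drg_b_gt0 drg lt.
move=> b0 [cc _] [_ bb] abc abc'; split.
- by rewrite mem_filter mem_iota; have := drg_mono drg (ltnW lt); lia.
- by rewrite mem_iota; lia.
- have lt' : (i.+1 < size c)%N by rewrite szc.
  by rewrite (take_nth 0%N lt) (take_nth 0%N lt').
Qed.

(* Nested conditionals: [andb] is strict under [vm_compute]. *)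
Definition feasible (b c : seq nat) (certs : seq (seq Z)) :=
  if [&& all (fun i => cnth c i.+1 %| spheresize b c i * nth 0 b i) (iota 0 (size b)),
      all (fun i => ~~ odd (spheresize b c i * anth b c i)) (iota 0 (size b).+1)
    & (size b == 3) && (anth b c 3 == 0) ==> (cnth c 2 %| nth 0 b 0 * (nth 0 b 2).-1)]%N
  then ~~ has (excludes b c) certs else false.

Lemma drg_feasible n (e : rel 'I_n) b c certs : is_DRG e b c -> feasible b c certs.
Proof.
move=> drg; rewrite /feasible ifT.
  by apply/hasPn => f _; apply/negP=> /(excludesF drg).
apply/and3P; split.
- by apply/allP => i; rewrite mem_iota => /andP[_ lt]; apply: (spheresize_dvd drg).
- by apply/allP => i; rewrite mem_iota => /andP[_ lt]; apply: (spheresize_even drg).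
- by apply/implyP=> /andP[/eqP D3 /eqP a3]; apply: (drg_c2_dvd drg).
Qed.

Definition antipodal3 (b c : seq nat) :=
  [&& size b == 3, nth 0 b 2 == 1 & nth 0 c 2 == nth 0 b 0]%N.

(* Factors f of U_(D+1) at whose roots the multiplicity of some feasible-looking array is not a
   natural number. *)
Definition certificates : seq (seq Z) :=
  [:: [:: 1]; [:: 0]; [:: -2];
      [:: -5; 1]; [:: -4; 1]; [:: -3; 0]; [:: -1; 3]; [:: 4; 10];
      [:: -15; -6; 5]; [:: -15; -4; 4]; [:: -12; -4; 4]; [:: -10; -4; 3]; [:: -9; -4; 3];
      [:: -8; -4; 3]; [:: -8; -3; 3]; [:: -7; -14; 7]; [:: -6; -12; 6]; [:: -5; -10; 5];
      [:: -4; -8; 4]; [:: -3; -6; 3]; [:: -2; -4; 1]; [:: -2; -4; 2]; [:: -1; -4; 1];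
      [:: 1; -4; 0]]%BZ.

Definition settled (st : seq nat * seq nat * (Z * Z)) :=
  if antipodal3 st.1.1 st.1.2 then true
  else if st.1 \in arrays_thm4p3 then true
  else if (st.2.1 <? 0)%BZ then true else ~~ feasible st.1.1 st.1.2 certificates.

Lemma settled_diameter3 : all (fun k => all settled (level k 2)) (iota 3 18).
Proof. by vm_compute. Qed.

Lemma settled_valency34 :
  all (fun k => [&& all settled (level k 3), all settled (level k 4) & nilp (level k 5)])
      [:: 3; 4].
Proof. by vm_compute. Qed.

(** * Bounds on the valency *)

Lemma c3_large (k b1 b2 c2 c3 : Z) : (4 < k -> 0 < b2 -> b1 <= k - 1 ->
  let q2 := (2 - k + b1 + c2) * 3 - b1 in
  0 < q2 -> 0 <= (2 - k + b2 + c3) * q2 - b2 * c2 * 3 -> k - 1 <= c3)%BZ.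
Proof.
move=> k4 b20 b1k q2 q2_gt0 q3_ge0; apply: Znot_gt_le => c3_lt.
have e_le : ((2 - k + b2 + c3) * q2 <= b2 * q2)%BZ by apply: Z.mul_le_mono_nonneg_r; lia.
have : (b2 * q2 < b2 * (c2 * 3))%BZ by apply: (proj1 (Z.mul_lt_mono_pos_l b2 _ _ _)); rewrite /q2; lia.
lia.
Qed.

Lemma valency_le4 (k b1 b2 b3 c2 c3 c4 : Z) :
  (0 < b2 -> 1 <= b3 -> b1 <= k - 1 -> b3 + c3 <= k -> c4 <= k ->
   let q2 := (2 - k + b1 + c2) * 3 - b1 in
   let q3 := (2 - k + b2 + c3) * q2 - b2 * c2 * 3 in
   let q4 := (2 - k + b3 + c4) * q3 - b3 * c3 * q2 in
   0 < q2 -> 0 < q3 -> 0 <= q4 -> k <= 4)%BZ.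
Proof.
move=> b20 b31 b1k b3c3 c4k q2 q3 q4 q2_gt0 q3_gt0 q4_ge0.
case: (Z_le_gt_dec k 4) => // k5; exfalso.
have c3_ge : (k - 1 <= c3)%BZ.
  by apply: (@c3_large k b1 b2 c2 c3) => //; [lia | rewrite -/q2 -/q3; lia].
have c3E : c3 = (k - 1)%BZ by lia.
have b3E : b3 = 1%BZ by lia.
have q2E : (q2 = q3 + b2 * (3 * k - 6 - 2 * b1))%BZ by rewrite /q3 /q2 c3E; ring.
have q_ge0 : (0 <= b2 * (3 * k - 6 - 2 * b1))%BZ by apply: Z.mul_nonneg_nonneg; lia.
have q4_le : (0 <= (k - c4) * q3)%BZ by apply: Z.mul_nonneg_nonneg; lia.
have kq2 : (0 <= (k - 5) * q2)%BZ by apply: Z.mul_nonneg_nonneg; lia.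
have q4E : (q4 = 3 * q3 - (k - 1) * q2 - (k - c4) * q3)%BZ by rewrite /q4 c3E b3E; ring.
lia.
Qed.

Lemma valency_le20 (k b1 b2 c2 c3 k2 k3 : Z) :
  (1 <= b2 <= b1 -> b1 <= k - 1 -> 1 <= c2 -> b2 + c2 <= k -> c3 <= k ->
   k2 * c2 = k * b1 -> k3 * c3 = k2 * b2 -> 1 <= k3 ->
   (c3 = k -> exists m, k * (b2 - 1) = m * c2) ->
   let q2 := (2 - k + b1 + c2) * 3 - b1 in
   0 < q2 -> 0 <= (2 - k + b2 + c3) * q2 - b2 * c2 * 3 -> k <= 20 \/ (b2 = 1 /\ c3 = k))%BZ.
Proof.
move=> [b21 b2b1] b1k c21 b2c2 c3k k2E k3E k31 dvd q2 q2_gt0 q3_ge0.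
case: (Z_le_gt_dec k 20) => [|k20]; [by left|right].
have c3_ge : (k - 1 <= c3)%BZ by apply: (@c3_large k b1 b2 c2 c3) => //; lia.
have [c3E|c3E] : c3 = k \/ c3 = (k - 1)%BZ by lia.
  case: (Z.eq_dec b2 1) => [b2E|b2E]; [by split|exfalso].
  have [m mE] := dvd c3E.
  have c2_ge : ((b2 + 2) * (3 * k - 2 * b1 - 6) <= 6 * c2)%BZ.
    by move: q3_ge0; rewrite /q2 c3E; lia.
  have q_ge : ((b2 + 2) * (k - 4) <= (b2 + 2) * (3 * k - 2 * b1 - 6))%BZ.
    by apply: Z.mul_le_mono_nonneg_l; lia.
  have b2_le : (b2 <= 4)%BZ.
    apply: Znot_gt_le => b5.
    have : (7 * (k - 4) <= (b2 + 2) * (k - 4))%BZ by apply: Z.mul_le_mono_nonneg_r; lia.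
    lia.
  have m_le : (m <= b2 - 1)%BZ.
    apply: Znot_gt_le => mb.
    have : (b2 * c2 <= m * c2)%BZ by apply: Z.mul_le_mono_nonneg_r; lia.
    have b2_234 : b2 = 2%BZ \/ b2 = 3%BZ \/ b2 = 4%BZ by lia.
    by case: b2_234 => [E|[E|E]]; subst b2; lia.
  have : (m * c2 <= (b2 - 1) * c2)%BZ by apply: Z.mul_le_mono_nonneg_r; lia.
  rewrite -mE Z.mul_comm => H.
  have : (k <= c2)%BZ by apply: (proj2 (Z.mul_le_mono_pos_l _ _ (b2 - 1)%BZ _)); lia.
  lia.
exfalso.
have c2_ge : ((b2 + 1) * (3 * k - 2 * b1 - 6) <= 3 * c2)%BZ.
  by move: q3_ge0; rewrite /q2 c3E; lia.
have q_ge : ((b2 + 1) * (k - 4) <= (b2 + 1) * (3 * k - 2 * b1 - 6))%BZ.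
  by apply: Z.mul_le_mono_nonneg_l; lia.
have kk : (k3 * ((k - 1) * c2) = k * b1 * b2)%BZ.
  have -> : (k3 * ((k - 1) * c2) = k3 * c3 * c2)%BZ by rewrite c3E; ring.
  have -> : (k3 * c3 * c2 = k2 * c2 * b2)%BZ by rewrite k3E; ring.
  by rewrite k2E.
have b2_le : (b2 <= 2)%BZ.
  apply: Znot_gt_le => b3.
  have : (4 * (k - 4) <= (b2 + 1) * (k - 4))%BZ by apply: Z.mul_le_mono_nonneg_r; lia.
  lia.
have [b2E|b2E] : b2 = 1%BZ \/ b2 = 2%BZ by lia.
  subst b2; have [k3E'|k3_ge] : k3 = 1%BZ \/ (2 <= k3)%BZ by lia.
    subst k3; case: (Z_le_gt_dec c2 b1) => [le|gt].
      have : ((k - 1) * c2 <= (k - 1) * b1)%BZ by apply: Z.mul_le_mono_nonneg_l; lia.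
      lia.
    have : ((k - 1) * (b1 + 1) <= (k - 1) * c2)%BZ by apply: Z.mul_le_mono_nonneg_l; lia.
    move=> H; have b1E : b1 = (k - 1)%BZ by lia.
    have : (c2 = k)%BZ by apply: (proj1 (Z.mul_cancel_l c2 k (k - 1)%BZ _)); rewrite ?b1E in kk *; lia.
    lia.
  have : (2 * ((k - 1) * c2) <= k3 * ((k - 1) * c2))%BZ.
    by apply: Z.mul_le_mono_nonneg_r => //; apply: Z.mul_nonneg_nonneg; lia.
  have : (k * b1 <= k * (k - 1))%BZ by apply: Z.mul_le_mono_nonneg_l; lia.
  move=> H1 H2.
  have : (2 * c2 <= k)%BZ by apply: (proj2 (Z.mul_le_mono_pos_l _ _ (k - 1)%BZ _)); lia.
  lia.
subst b2.
have [b1E|b1E] : b1 = (k - 2)%BZ \/ b1 = (k - 1)%BZ by lia.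
  have c2E : c2 = (k - 2)%BZ by lia.
  have : (k3 * (k - 1) = 2 * k)%BZ.
    by apply: (proj1 (Z.mul_cancel_l _ _ (k - 2)%BZ _)); rewrite ?b1E ?c2E in kk *; lia.
  case: (Z_le_gt_dec k3 2) => [le|gt].
    have : (k3 * (k - 1) <= 2 * (k - 1))%BZ by apply: Z.mul_le_mono_nonneg_r; lia.
    lia.
  have : (3 * (k - 1) <= k3 * (k - 1))%BZ by apply: Z.mul_le_mono_nonneg_r; lia.
  lia.
have : (k3 * c2 = 2 * k)%BZ.
  by apply: (proj1 (Z.mul_cancel_l _ _ (k - 1)%BZ _)); rewrite ?b1E in kk *; lia.
case: (Z_le_gt_dec k3 2) => [le|gt].
  have : (k3 * c2 <= 2 * c2)%BZ by apply: Z.mul_le_mono_nonneg_r; lia.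
  lia.
have : (3 * c2 <= k3 * c2)%BZ by apply: Z.mul_le_mono_nonneg_r; lia.
lia.
Qed.

(** * Antipodal covers of complete graphs *)

Section AntipodalCovers.

Variables (n : nat) (e : rel 'I_n) (k b1 c2 : nat).
Let b := [:: k; b1; 1%N].
Let c := [:: 1%N; c2; k].
Hypothesis drg : is_DRG e b c.
Hypothesis k_gt0 : (0 < k)%N.

Let s : Z := (zn k - 1 - zn b1 - zn c2)%BZ.

Lemma antipodal_anth : [/\ (anth b c 1 + b1 + 1 = k)%N, (anth b c 2 + 1 + c2 = k)%N,
  anth b c 3 = 0%N & (0 < c2)%N].
Proof.
have := drg_abc drg (isT : 1 <= 3)%N; have := drg_abc drg (isT : 2 <= 3)%N.
have := drg_abc drg (isT : 3 <= 3)%N; have := drg_c_gt0 drg (isT : 0 < 2 <= 3)%N.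
by rewrite /b /c /cnth /=; split; lia.
Qed.

Lemma antipodal_fibre : exists t : nat, [/\ (0 < t)%N, (t * c2 = b1)%N & n = ((k + 1) * (t + 1))%N].
Proof.
have [x _] := drg_diameter drg; have [_ _ _ c2_gt0] := antipodal_anth.
have := sum_sphere drg x; rewrite !big_ord_recl big_ord0 /= !/bump /= (sphere0 drg).
have := sphere_rec drg x 0%N; have := sphere_rec drg x 1%N; have := sphere_rec drg x 2%N.
rewrite (sphere0 drg) /b /c /cnth /= !muln1 mul1n => E3 E2 E1 En.
exists (sphere e x 3%N).
have tc2 : (sphere e x 3%N * c2 = b1)%N.
  apply/eqP; rewrite -(eqn_pmul2l k_gt0); apply/eqP.
  by rewrite mulnA [(k * _)%N]mulnC -E3 -E2 -E1.
split=> //; last by move: En; rewrite -E1 E3 => /esym En; rewrite [LHS]En; ring.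
rewrite lt0n; apply/eqP=> t0; rewrite t0 mul0n in tc2.
by have := drg_b_gt0 drg (isT : 1 < 3)%N; rewrite /b /= -tc2.
Qed.

Section Root.

Variables (R : comNzRingType) (x : R).
Hypothesis x_root : x ^+ 2 = zr R s * x + k%:R.

Let sE : zr R s = k%:R - 1 - b1%:R - c2%:R.
Proof. by rewrite /s /Z.sub !zrD !zrN !zr_nat. Qed.

Lemma antipodal_Useq :
  [/\ Useq b c x 2 = - c2%:R * x, Useq b c x 3 = - c2%:R * k%:R & Useq b c x 4 = 0].
Proof.
have [/(congr1 (fun m => m%:R : R)) a1 /(congr1 (fun m => m%:R : R)) a2 a3 _] := antipodal_anth.
rewrite !natrD in a1 a2.
have U2 : Useq b c x 2 = - c2%:R * x.
  rewrite UseqSS Useq1 Useq0 [nth _ _ _]/= [cnth _ _]/= muln1 mulr1.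
  have -> : (anth b c 1)%:R = k%:R - b1%:R - 1 :> R by rewrite -a1; ring.
  by rewrite mulrBl -expr2 x_root sE; ring.
have U3 : Useq b c x 3 = - c2%:R * k%:R.
  rewrite UseqSS U2 Useq1 [nth _ _ _]/= [cnth _ _]/= natrM.
  have -> : (anth b c 2)%:R = k%:R - c2%:R - 1 :> R by rewrite -a2; ring.
  transitivity (- c2%:R * (x ^+ 2 - (k%:R - c2%:R - 1 - b1%:R) * x)); first by ring.
  by rewrite x_root sE; ring.
split=> //; rewrite UseqSS U3 U2 a3 [nth _ _ _]/= [cnth _ _]/= mul1n; ring.
Qed.

Lemma antipodal_Ssum : Ssum b c x =
  k%:R * c2%:R * (b1 + c2)%:R * (2 * k%:R + zr R s * x).
Proof.
have [U2 U3 _] := antipodal_Useq.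
rewrite /Ssum !big_ord_recl big_ord0 /= /bump /= ![(1 + _)%N]/= U2 U3 Useq0 Useq1.
rewrite /bprod /cprod unlock /= /cnth /= !natrM !natrD.
transitivity (k%:R * c2%:R * (b1%:R + c2%:R) * (k%:R + x ^+ 2) : R); first by ring.
by rewrite x_root; ring.
Qed.

End Root.

Lemma antipodal_multiplicity (x : algC) t : (t * c2 = b1)%N -> n = ((k + 1) * (t + 1))%N ->
  x ^+ 2 = zr algC s * x + k%:R ->
  exists m : nat, (k * (k + 1) * t)%:R = m%:R * (2 * k%:R + zr algC s * x).
Proof.
move=> tc2 nE xE; have [_ _ U4] := antipodal_Useq xE.
have [m] := multiplicity drg (U4 : Useq b c x (size b).+1 = 0).
rewrite (antipodal_Ssum xE) => mE; exists m.
have [_ _ _ c2_gt0] := antipodal_anth.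
have K0 : (k * (c2 * c2) * (t + 1))%:R != 0 :> algC.
  by rewrite pnatr_eq0 !muln_eq0; lia.
have E : (k * (c2 * c2) * (t + 1) * (k * (k + 1) * t) = n * (bprod b 0 * cprod c 0))%N.
  by rewrite nE /bprod /cprod unlock /= /cnth /= -tc2; ring.
have := congr1 (fun m => m%:R : algC) E; rewrite natrM mE => {}E.
by apply: (mulfI K0); rewrite [LHS]E -tc2 !natrM !natrD; ring.
Qed.

Lemma antipodal_qseq (R : comPzRingType) (x : R) :
  qseq b c x 3 = (x + 1) * (x ^+ 2 - (k%:R - 1 - b1%:R - c2%:R) * x - k%:R).
Proof.
rewrite !(qseqSS drg) // qseqS qseq0 Useq1 /cnth /= !natrM; ring.
Qed.

End AntipodalCovers.

Lemma antipodal_integral n (e : rel 'I_n) (k b1 c2 : nat) :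
  is_DRG e [:: k; b1; 1%N] [:: 1%N; c2; k] -> (0 < k)%N ->
  let s := (zn k - 1 - zn b1 - zn c2)%BZ in
  s = 0%BZ \/ exists z, (z * z = s * z + zn k)%BZ.
Proof.
move=> drg k_gt0 s; pose f := [:: - zn k; - s]%BZ.
case: (boolP (noZroot f)) => [noroot|].
  left; have [x /rootP] : exists x, root (polyl algC f) x.
    by apply/closed_rootP; rewrite size_polyl.
  rewrite horner_polyl !ev_cons !zrN /ev /= zr_nat => fx.
  have xE : x ^+ 2 = zr algC s * x + k%:R.
    by apply/eqP; rewrite -subr_eq0; apply/eqP; rewrite -[RHS]fx; ring.
  have [t [t_gt0 tc2 nE]] := antipodal_fibre drg k_gt0.
  have [m mE] := antipodal_multiplicity drg k_gt0 tc2 nE xE.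
  pose N := (k * (k + 1) * t)%N.
  have := @ev_small_eq0 f x [:: 2 * zn k * zn m - zn N; zn m * s]%BZ _ _ _ _.
  have irr : (size f == 1%N) || (1 < size f <= 3)%N && noZroot f by rewrite noroot.
  have fx' : (polyl algC f).[x] = 0.
    by rewrite horner_polyl !ev_cons !zrN /ev /= zr_nat.
  have gx : ev x [:: 2 * zn k * zn m - zn N; zn m * s]%BZ = 0.
    rewrite !ev_cons /Z.sub zrD zrN !zrM !zr_nat /ev /= mulr0 addr0 mE.
    by rewrite -[2%BZ]/(zn 2) zr_nat -/s; ring.
  move=> /(_ irr fx' isT gx) /and3P[/eqP g0 /eqP g1 _].
  have N_gt0 : (0 < N)%N by rewrite !muln_gt0 k_gt0 t_gt0 addn1.
  have m_neq0 : zn m <> 0%BZ by move=> m0; rewrite m0 in g0; lia.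
  by case/Z.mul_eq_0: g1.
rewrite /noZroot negb_and negbK => /orP[/eqP /=|/allPn[i _]]; first by lia.
rewrite negb_and !negbK => /orP[] /eqP /= E; right.
  by exists (zn i); lia.
by exists (- zn i)%BZ; lia.
Qed.

Lemma no_drg_20_18_1 n (e : rel 'I_n) : is_DRG e [:: 20; 18; 1]%N [:: 1; 9; 20]%N -> False.
Proof.
move=> drg; set b := [:: 20; 18; 1]%N in drg *; set c := [:: 1; 9; 20]%N in drg *.
pose x : rat := - 10%:R.
have U2 : Useq b c x 2 = 90%:R.
  by rewrite UseqSS Useq1 Useq0 (_ : anth b c 1 = 1%N) // /cnth [nth _ _ _]/= [nth _ _ _]/= natrM /x; ring.
have U3 : Useq b c x 3 = - 180%:R.
  by rewrite UseqSS U2 Useq1 (_ : anth b c 2 = 10%N) // /cnth [nth _ _ _]/= [nth _ _ _]/= natrM /x; ring.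
have U4 : Useq b c x (size b).+1 = 0.
  by rewrite UseqSS U3 U2 (_ : anth b c 3 = 0%N) // /cnth [nth _ _ _]/= [nth _ _ _]/= natrM /x; ring.
have := krein_spheresize drg U4.
have sum4 (F : nat -> rat) (g : nat -> nat) : \sum_(i < 4) F i *+ g i =
    F 0%N *+ g 0%N + F 1%N *+ g 1%N + F 2%N *+ g 2%N + F 3%N *+ g 3%N.
  by rewrite !big_ord_recl big_ord0 !addrA addr0.
rewrite (sum4 (fun i => wseq b c x i ^+ 3) (spheresize b c)).
have [-> -> -> ->] : [/\ spheresize b c 0 = 1, spheresize b c 1 = 20,
    spheresize b c 2 = 40 & spheresize b c 3 = 2]%N by split; vm_compute.
pose w : rat := 90%:R; have w_gt0 : 0 < w by [].
have [w0 w1 w2 w3] : [/\ wseq b c x 0 = 4%:R * w, wseq b c x 1 = - 2%:R * w,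
    wseq b c x 2 = w & wseq b c x 3 = - 2%:R * w].
  by rewrite /wseq U2 U3 Useq0 Useq1 /bprod unlock /= !natrM /w /x; split; ring.
rewrite w0 w1 w2 w3.
clear w0 w1 w2 w3; clearbody w.
rewrite (_ : _ + _ = - (72%:R * w ^+ 3)); last by ring.
by rewrite oppr_ge0 leNgt mulr_gt0 ?ltr0n ?exprn_gt0.
Qed.

Lemma qZS b c i : qZ b c i.+1 =
  (((2 - zn (nth 0%N b 0%N) + zn (nth 0%N b i.+1) + zn (cnth c i.+2)) * (qZ b c i).1
    - zn (nth 0%N b i.+1) * zn (cnth c i.+1) * (qZ b c i).2)%BZ, (qZ b c i).1).
Proof. by []. Qed.

Lemma antipodal_arrays (R : rcfType) n (e : rel 'I_n) (k b1 c2 : nat) (th : R) :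
    is_DRG e [:: k; b1; 1%N] [:: 1%N; c2; k] -> (3 <= k)%N ->
    0 <= qseq [:: k; b1; 1%N] [:: 1%N; c2; k] (2 : R) 3 ->
    eigenvalue (adjmx R e) th -> 1 < th < k%:R ->
  ([:: k; b1; 1%N], [:: 1%N; c2; k]) \in arrays_thm4p3.
Proof.
move=> drg k3 q3 eig /andP[th1 thk]; have k_gt0 : (0 < k)%N by rewrite ltnW // ltnW.
pose s := (zn k - 1 - zn b1 - zn c2)%BZ.
have sE : zr R s = k%:R - 1 - b1%:R - c2%:R by rewrite /s /Z.sub !zrD !zrN !zr_nat.
have f2 : (0 <= 4 - zn k - 2 * s)%BZ.
  have zr_ge0 z : 0 <= zr R z -> (0 <= z)%BZ by rewrite /zr ler0z; lia.
  apply: zr_ge0; rewrite /Z.sub !zrD !zrN zrM sE.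
  move: q3; rewrite (antipodal_qseq drg) -[4%BZ]/(zn 4) -[2%BZ]/(zn 2) !zr_nat => q3.
  rewrite -(pmulr_rge0 _ (_ : 0 < 2 + 1 :> R)) ?addr_gt0 //.
  by apply: le_trans q3 _; rewrite le_eqVlt; apply/orP; left; apply/eqP; ring.
have f1 : th ^+ 2 - zr R s * th - k%:R = 0.
  have /eqP := eigenvalue_Useq drg eig; rewrite (Useq_last drg) (antipodal_qseq drg) -sE.
  rewrite !mulf_eq0 subr_eq0 (lt_eqF thk) /= => /orP[|/eqP //].
  by rewrite gt_eqF // ltr_wpDl // ltW // (lt_trans ltr01).
have [t [t_gt0 tc2 nE]] := antipodal_fibre drg k_gt0.
have [a1E a2E _ c2_gt0] := antipodal_anth drg k_gt0.
have [s0|[z zE]] : s = 0%BZ \/ exists z, (z * z = s * z + zn k)%BZ :=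
  antipodal_integral drg k_gt0.
  have k4 : (k == 3) || (k == 4) by lia.
  have b1E : ((t + 1) * c2 + 1 = k)%N by lia.
  case/orP: k4 => /eqP kE; subst k.
    have : (t + 1 <= (t + 1) * c2)%N by rewrite leq_pmulr.
    have [E|E] : t = 1%N \/ (2 <= t)%N by lia.
    (* k = 3 and a_1 = 1 contradict the parity of k a_1. *)
      subst t; have c2E : c2 = 1%N by lia.
      subst c2; rewrite mul1n in tc2; subst b1.
      by have := spheresize_even drg (isT : 1 <= 3)%N.
    by lia.
  have : (t + 1 <= (t + 1) * c2)%N by rewrite leq_pmulr.
  have [E|[E|E]] : t = 1%N \/ t = 2%N \/ (3 <= t)%N by lia.
  - by subst t; lia.
  - subst t; have c2E : c2 = 1%N by lia.
    by subst c2; rewrite -tc2.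
  - by lia.
have zz' : (z * (z - s) = zn k)%BZ by lia.
have [p [u [p0 u0 puE suE]]] : exists p u, [/\ 0 < p, 0 < u, zn k = p * u & s = p - u]%BZ.
  case: (Z_lt_le_dec 0 z) => [z0|z0].
    exists z, (z - s)%BZ; split=> //; try lia.
  have z_neg : (z < 0)%BZ by case: (Z.eq_dec z 0) => [z0'|]; [rewrite z0' in zz'; lia|lia].
  exists (s - z)%BZ, (- z)%BZ; split; try lia.
  have : (0 < - z * (s - z))%BZ by lia.
  by move/Z.mul_pos_cancel_l; apply; lia.
have p2 : (p <= 2)%BZ.
  apply: Znot_gt_le => p3.
  have : (0 < (p - 2) * (2 + u))%BZ by apply: Z.mul_pos_pos; lia.
  lia.
have [pE|pE] : p = 1%BZ \/ p = 2%BZ by lia.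
  subst p; have uE : u = zn k by lia.
  move: f1; rewrite suE uE /Z.sub zrD zrN zr_nat -[1%BZ]/(zn 1) zr_nat => f1.
  have : (th - 1) * (th + k%:R) == 0 by rewrite -f1; apply/eqP; ring.
  by rewrite mulf_eq0 subr_eq0 (gt_eqF th1) /= gt_eqF // addr_gt0 ?ltr0n // (lt_trans ltr01).
subst p; have [w wE] : exists w : nat, u = zn w by exists (Z.to_nat u); lia.
subst u; have kE : k = (2 * w)%N by lia.
have xE : (2 : algC) ^+ 2 = zr algC s * 2 + k%:R.
  by rewrite suE /Z.sub zrD zrN -[2%BZ]/(zn 2) !zr_nat kE natrM; ring.
have [m] := antipodal_multiplicity drg k_gt0 tc2 nE xE.
rewrite -/s suE /Z.sub zrD zrN -[2%BZ]/(zn 2) !zr_nat => mE.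
have {}mE : (k * (k + 1) * t = m * (2 * w + 4))%N.
  by apply/eqP; rewrite -(eqr_nat algC) mE kE !(natrM, natrD); apply/eqP; ring.
have {}mE : (w * (2 * w + 1) * t = m * (w + 2))%N.
  by apply/eqP; rewrite -(eqn_pmul2l (isT : 0 < 2)%N); apply/eqP; rewrite kE in mE; lia.
have dvd : (w + 2 %| 6 * t)%N.
  rewrite -(dvdn_addr _ (dvdn_mull ((2 * w) * t) (dvdnn (w + 2)))).
  apply/dvdnP; exists (m + 3 * t)%N; rewrite mulnDl -mE; ring.
have c2E : ((t + 1) * c2 = 3 * (w - 1))%N by lia.
have w_ge2 : (2 <= w)%N by lia.
have c2_ge : (w - 2 <= c2)%N by lia.
have t1 : t <> 1%N.
  move=> tE; subst t; have : (w + 2 <= 6)%N by apply: dvdn_leq dvd.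
  move=> w4; have : [|| w == 2, w == 3 | w == 4]%N by lia.
  by case/or3P=> /eqP wE; subst w; lia || (move: dvd; rewrite /=; lia).
have [tE|t3] : t = 2%N \/ (3 <= t)%N by lia.
  subst t; have : (w + 2 <= 12)%N by apply: dvdn_leq dvd.
  move=> w10; have c2w : c2 = (w - 1)%N by lia.
  have b1w : b1 = (2 * (w - 1))%N by lia.
  have win : w \in iota 2 9 by rewrite mem_iota; lia.
  have small : all (fun w => (w + 2 %| 12) ==> (w \in [:: 2; 4; 10]))%N (iota 2 9) by [].
  have := implyP (allP small w win) dvd; rewrite !inE => /or3P[]/eqP E; subst w k b1 c2 => //.
  by have := no_drg_20_18_1 drg.
have c2_le : (4 * c2 <= (t + 1) * c2)%N by rewrite leq_mul2r; lia.
have : [|| w == 2, w == 3, w == 4 | w == 5]%N by lia.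
case/or4P=> /eqP E; subst w.
- by lia.
- have c2E' : c2 = 1%N by lia.
  by subst c2; have tE : t = 5%N by [lia]; subst t k b1.
- have c2E' : c2 = 2%N by lia.
  by subst c2; lia.
- have c2E' : c2 = 3%N by lia.
  by subst c2; have tE : t = 3%N by [lia]; subst t.
Qed.

Lemma antipodal3_arrays (R : rcfType) n (e : rel 'I_n) (b c : seq nat) (th : R) :
    is_DRG e b c -> (3 <= nth 0 b 0)%N -> antipodal3 b c -> 0 <= qseq b c (2 : R) (size b) ->
    eigenvalue (adjmx R e) th -> 1 < th < (nth 0%N b 0)%:R ->
  (b, c) \in arrays_thm4p3.
Proof.
move=> drg k3 /and3P[/eqP D3 /eqP b2 /eqP c3]; have := drg_size drg; have := drg_c1 drg.
move: drg k3 D3 b2 c3.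
case: b => [|k [|b1 [|? [|]]]] //; case: c => [|? [|c2 [|? [|]]]] //= drg k3 _ b2 c3.
rewrite /cnth /= => /(_ isT) c1 _; subst; exact: antipodal_arrays.
Qed.

Local Close Scope ring_scope.

Lemma drg_valency_le20 n (e : rel 'I_n) (b c : seq nat) : is_DRG e b c -> size b = 3 ->
  (0 < (qZ b c 1).1)%BZ -> (0 <= (qZ b c 2).1)%BZ -> nth 0 b 0 <= 20 \/ antipodal3 b c.
Proof.
move=> drg D3; have D3' : 3 <= size b by rewrite D3.
have c1 := drg_c1 drg (ltnW (ltnW D3')).
have abc1 := drg_abc drg (ltnW (ltnW D3') : 1 <= size b).
have abc2 := drg_abc drg (ltnW D3' : 2 <= size b).
have abc3 := drg_abc drg D3'.
have [_ b21] := drg_mono drg (ltnW D3' : 1 < size b).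
have b1_gt0 := drg_b_gt0 drg (ltnW D3' : 1 < size b).
have b2_gt0 := drg_b_gt0 drg D3'.
have c2_gt0 := drg_c_gt0 drg (ltnW D3' : 0 < 2 <= size b).
have c3_gt0 := drg_c_gt0 drg (D3' : 0 < 3 <= size b).
have [x _] := drg_diameter drg.
have r0 := sphere_rec drg x 0; have r1 := sphere_rec drg x 1; have r2 := sphere_rec drg x 2.
rewrite (sphere0 drg) c1 mul1n muln1 in r0; rewrite -r0 in r1.
have s2_gt0 : 0 < sphere e x 2.
  by rewrite -(ltn_pmul2r c2_gt0) mul0n -r1 muln_gt0 b1_gt0 andbT (drg_b_gt0 drg (ltnW (ltnW D3'))).
have s3_gt0 : 0 < sphere e x 3 by rewrite -(ltn_pmul2r c3_gt0) mul0n -r2 muln_gt0 s2_gt0.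
have dvd : zn (cnth c 3) = zn (nth 0%N b 0%N) ->
    exists m, (zn (nth 0%N b 0%N) * (zn (nth 0%N b 2) - 1) = m * zn (cnth c 2))%BZ.
  move=> c3E; have a3 : anth b c 3 = 0 by clear -c3E; rewrite /anth; lia.
  case/dvdnP: (drg_c2_dvd drg D3 a3) => m mE; exists (zn m).
  clear -mE b2_gt0; move: mE b2_gt0; case: (nth 0%N b 2) => [|p] // mE _.
  rewrite succnK in mE; have -> : (zn p.+1 - 1 = zn p)%BZ by lia.
  by lia.
rewrite (qZS b c 1) (qZS b c 0) /= c1 Z.mul_1_r Z.mul_1_r => q2 q3.
have [] := @valency_le20 (zn (nth 0%N b 0%N)) (zn (nth 0%N b 1)) (zn (nth 0%N b 2)) (zn (cnth c 2))
  (zn (cnth c 3)) (zn (sphere e x 2)) (zn (sphere e x 3)) _ _ _ _ _ _ _ _ dvd q2 q3.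
all: clear q2 q3 dvd; try lia.
by case=> b2E c3E; right; rewrite /antipodal3 D3 /=; rewrite /cnth in c3E; lia.
Qed.

Lemma drg_valency_le4 n (e : rel 'I_n) (b c : seq nat) : is_DRG e b c -> 4 <= size b ->
  (0 < (qZ b c 1).1)%BZ -> (0 < (qZ b c 2).1)%BZ -> (0 <= (qZ b c 3).1)%BZ -> nth 0 b 0 <= 4.
Proof.
move=> drg D4; have c1 := drg_c1 drg (ltnW (ltnW (ltnW D4))).
have abc1 := drg_abc drg (ltnW (ltnW (ltnW D4)) : 1 <= size b).
have abc3 := drg_abc drg (ltnW D4 : 3 <= size b).
have abc4 := drg_abc drg D4.
have b2_gt0 := drg_b_gt0 drg (ltnW D4 : 2 < size b).
have b3_gt0 := drg_b_gt0 drg (D4 : 3 < size b).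
rewrite (qZS b c 2) (qZS b c 1) (qZS b c 0) /= c1 Z.mul_1_r Z.mul_1_r => q2 q3 q4.
have := @valency_le4 (zn (nth 0%N b 0%N)) (zn (nth 0%N b 1)) (zn (nth 0%N b 2)) (zn (nth 0%N b 3))
  (zn (cnth c 2)) (zn (cnth c 3)) (zn (cnth c 4)) _ _ _ _ _ q2 q3 q4.
by clear q2 q3 q4; lia.
Qed.

Theorem theorem4p3 (R : rcfType) (n : nat) (e : rel 'I_n) (b c : seq nat) :
  is_DRG e b c ->
  (3 <= nth 0 b 0)%N ->
  (3 <= size b)%N ->
  (exists th1 : R,
      is_theta1 (adjmx R e) (nth 0 b 0)%:R th1 /\ (1 < th1 <= 2)%R) ->
  (b, c) \in arrays_thm4p3.
Proof.
move=> drg k3 D3 [th [[eig thk second] /andP[th1 th2]]].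
have second2 r : eigenvalue (adjmx R e) r -> (r < (nth 0 b 0)%:R -> r <= 2)%R.
  by move=> er rk; apply: le_trans th2; apply: second.
have [|q_gt0 qD_ge0] := qseq_two drg (ltnW (ltnW D3)) _ second2.
  by rewrite ler_nat ltnW.
have qZ_gt0 i : i.+1 < size b -> (0 < (qZ b c i).1)%BZ.
  move=> lt; have := q_gt0 _ lt; have [<- _] := zr_qZ R drg (ltnW lt).
  by rewrite /zr ltr0z; lia.
have D_gt0 : (size b).-1 < size b by rewrite prednK // ltnW // ltnW.
have qZ_ge0 : (0 <= (qZ b c (size b).-1).1)%BZ.
  move: qD_ge0; have [+ _] := zr_qZ R drg D_gt0; rewrite prednK ?(ltnW (ltnW D3)) // => <-.
  by rewrite /zr ler0z; lia.
have in_level : (b, c, qZ b c (size b).-1) \in level (nth 0 b 0) (size b).-1.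
  have := mem_level drg D_gt0 _; rewrite prednK ?(ltnW (ltnW D3)) //.
  rewrite take_size -{2}(drg_size drg) take_size; apply=> j lt.
  by apply: qZ_gt0; rewrite -ltn_predRL.
have anti_in : antipodal3 b c -> (b, c) \in arrays_thm4p3.
  by move=> anti; apply: (antipodal3_arrays drg k3 anti qD_ge0 eig); rewrite th1.
have settledP : settled (b, c, qZ b c (size b).-1) -> (b, c) \in arrays_thm4p3.
  rewrite /settled /=; case: (antipodal3 b c) anti_in => [-> //|_].
  case: (_ \in _) => //; case: Z.ltb_spec0 => [lt|_]; first by lia.
  by rewrite (drg_feasible _ drg).
have [D3E|D4] : size b = 3 \/ 4 <= size b by clear -D3; lia.
  have [k20|anti] : nth 0 b 0 <= 20 \/ antipodal3 b c.
  - by apply: (drg_valency_le20 drg D3E); [apply: qZ_gt0; rewrite D3E | rewrite D3E in qZ_ge0].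
  - have kin : nth 0 b 0 \in iota 3 18 by rewrite mem_iota k3 ltnS.
    apply: settledP; rewrite D3E in in_level *.
    exact: (allP (allP settled_diameter3 _ kin) _ in_level).
  - exact: anti_in.
have k4 : nth 0 b 0 <= 4.
  apply: (drg_valency_le4 drg D4); try exact: qZ_gt0.
  move: D4; rewrite leq_eqVlt => /predU1P[D4E|/qZ_gt0/Z.lt_le_incl //].
  by rewrite -D4E in qZ_ge0.
have kin : nth 0 b 0 \in [:: 3; 4] by clear -k3 k4; rewrite !inE; lia.
have /and3P[lv3 lv4 lv5] := allP settled_valency34 _ kin.
have [D6|[D4E|D5E]] : 5 < size b \/ size b = 4 \/ size b = 5 by clear -D4; lia.
- have := mem_level drg D6 (fun j lt => qZ_gt0 j (leq_ltn_trans lt D6)).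
  by rewrite (nilP lv5).
- by apply: settledP; rewrite D4E in in_level *; apply: (allP lv3).
- by apply: settledP; rewrite D5E in in_level *; apply: (allP lv4).
Qed.
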